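(* Suppose $\alpha_1<1/2$, let $\gamma=1-2\alpha_1>0$ and $\rho>\rho_c$. Then for $\lambda>0$, $$\lim_{V\to\infty}\Big\langle\exp\Big\{\lambda V^\gamma\Big(\frac{N_1}{V}-\Big\langle\frac{N_1}{V}\Big\rangle^C_V(\rho)\Big)\Big\}\Big\rangle^C_V(\rho)=\begin{cases}\exp(g_1(\lambda)),&\alpha_3<\alpha_2<\alpha_1<1/2,\\ \exp(2g_1(\lambda)+g_2(\lambda)),&\alpha_3<\alpha_2=\alpha_1<1/2,\\ \exp(3g_1(\lambda)+3g_2(\lambda)+g_3(\lambda)),&\alpha_3=\alpha_2=\alpha_1=1/3,\end{cases}$$ where, with $h_\lambda(\eta)=-\ln\big(1+\frac{\lambda}{\beta\eta}\big)+\frac{\lambda}{\beta\eta}$ and $e(m)=\frac{\pi^2}{2}(m^2-1)$, $g_1(\lambda)=\sum_{m\ge2}h_\lambda(e(m))$, $g_2(\lambda)=\sum_{m_1,m_2\ge2}h_\lambda(e(m_1)+e(m_2))$, $g_3(\lambda)=\sum_{m_1,m_2,m_3\ge2}h_\lambda(e(m_1)+e(m_2)+e(m_3))$.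
   Context: Fix exponents $\alpha_1\ge\alpha_2\ge\alpha_3>0$ with $\alpha_1+\alpha_2+\alpha_3=1$ and $\Lambda_V=\{x\in\mathbb{R}^3:0\le x_j\le V^{\alpha_j}\}$. The one-particle Hamiltonian $-\Delta/2$ on $L^2(\Lambda_V)$ with Dirichlet boundary conditions has eigenvalues $\frac{\pi^2}{2}\sum_jn_j^2V^{-2\alpha_j}$, $n_j\ge1$; $N_1$ is the occupation number of the ground state $\mathbf{n}=(1,1,1)$. Perfect Bose gas at inverse temperature $\beta>0$; canonical state at density $\rho=N/V$: $\langle\cdot\rangle^C_V(\rho)=Z_V(N)^{-1}\mathrm{Tr}(\cdot\,e^{-\beta T_V^{(N)}})$ on the symmetric $N$-particle space; limit at fixed $\rho$: $N$ particles in volume $V=N/\rho$, $N\to\infty$. $F(\eta)=\frac{\sqrt2}{3\pi^2}\eta^{3/2}$, $\rho_c=\int_0^\infty(e^{\beta\eta}-1)^{-1}F(d\eta)$. *)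

(* Defs.v *)
From HB Require Import structures.
From mathcomp Require Import all_boot all_order all_algebra.
From mathcomp Require Import finmap.
From mathcomp Require Import all_classical all_reals all_analysis.
Set Implicit Arguments. Unset Strict Implicit. Unset Printing Implicit Defensive.
Import Order.TTheory GRing.Theory Num.Theory.
Import numFieldNormedType.Exports.
Local Open Scope classical_set_scope.
Local Open Scope ring_scope.

(* One-particle modes: k = (k1,k2,k3) encodes the Dirichlet quantum numbers
   n_j = k_j + 1 >= 1. *)
Definition mode := (nat * nat * nat)%type.

Definition ground_mode : mode := (0%N, 0%N, 0%N).

(* Occupation-number configurations (the symmetric N-particle space of the
   perfect Bose gas has the basis of occupation numbers n_k, k a mode,
   finitely supported, with sum_k n_k = N). *)
Definition occ := {fsfun mode -> nat with 0%N}.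

Definition occ_total (n : occ) : nat := (\sum_(k <- finsupp n) n k)%N.

Definition configs (N : nat) : set occ := [set n | occ_total n = N].

Section BoseGas.
Variable R : realType.

(* Eigenvalue of -Delta/2 with Dirichlet b.c. on
   Lambda_V = prod_j [0, V^{alpha_j}] :
   pi^2/2 * sum_j n_j^2 V^{-2 alpha_j}. *)
Definition eps (a1 a2 a3 V : R) (k : mode) : R :=
  pi ^+ 2 / 2 *
  ((k.1.1).+1%:R ^+ 2 * V `^ (- (2 * a1)) +
   (k.1.2).+1%:R ^+ 2 * V `^ (- (2 * a2)) +
   (k.2).+1%:R ^+ 2 * V `^ (- (2 * a3))).

(* T_V^{(N)} acting on the occupation basis vector n. *)
Definition energy (a1 a2 a3 V : R) (n : occ) : R :=
  \sum_(k <- finsupp n) (n k)%:R * eps a1 a2 a3 V k.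

Definition boltz (beta a1 a2 a3 V : R) (n : occ) : R :=
  expR (- (beta * energy a1 a2 a3 V n)).

Definition Zcan (beta a1 a2 a3 V : R) (N : nat) : \bar R :=
  \esum_(n in configs N) (boltz beta a1 a2 a3 V n)%:E.

(* Canonical expectation <A>^C_V of a (nonnegative) function A of the
   occupation numbers, i.e. of the operator diagonal in the occupation basis. *)
Definition canon_expect (beta a1 a2 a3 V : R) (N : nat) (A : occ -> R) : R :=
  fine (\esum_(n in configs N) (A n * boltz beta a1 a2 a3 V n)%:E)
  / fine (Zcan beta a1 a2 a3 V N).

Definition N1 (n : occ) : nat := n ground_mode.

(* critical density rho_c = int_0^oo (e^{beta eta} - 1)^{-1} F(d eta),
   F(eta) = sqrt 2/(3 pi^2) eta^{3/2}, so F(d eta) = sqrt 2/(2 pi^2) eta^{1/2} d eta. *)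
Definition rho_c (beta : R) : \bar R :=
  (\int[lebesgue_measure]_(eta in [set x : R | (0 < x)%R])
     ((expR (beta * eta) - 1)^-1 * (Num.sqrt 2 / (2 * pi ^+ 2)) * Num.sqrt eta)%:E)%E.

Definition h_lam (beta lam eta : R) : R :=
  - ln (1 + lam / (beta * eta)) + lam / (beta * eta).

Definition e_m (m : nat) : R := pi ^+ 2 / 2 * (m%:R ^+ 2 - 1).

Definition g1 (beta lam : R) : R :=
  fine (\esum_(m in [set m : nat | (2 <= m)%N]) (h_lam beta lam (e_m m))%:E).

Definition g2 (beta lam : R) : R :=
  fine (\esum_(m in [set m : nat * nat | (2 <= m.1)%N /\ (2 <= m.2)%N])
          (h_lam beta lam (e_m m.1 + e_m m.2))%:E).

Definition g3 (beta lam : R) : R :=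
  fine (\esum_(m in [set m : nat * nat * nat |
                     [/\ (2 <= m.1.1)%N, (2 <= m.1.2)%N & (2 <= m.2)%N]])
          (h_lam beta lam (e_m m.1.1 + e_m m.1.2 + e_m m.2))%:E).

(* The fluctuation functional at particle number N, volume V = N / rho:
   < exp{ lam V^gamma (N1/V - <N1/V>) } >^C_V(rho). *)
Definition fluct_mgf (beta a1 a2 a3 rho lam : R) (N : nat) : R :=
  let V := N%:R / rho in
  let gam := 1 - 2 * a1 in
  let m1 := canon_expect beta a1 a2 a3 V N (fun n => (N1 n)%:R / V) in
  canon_expect beta a1 a2 a3 V N
    (fun n => expR (lam * V `^ gam * ((N1 n)%:R / V - m1))).

End BoseGas.

(* Main.v *)
Require Import Defs.
From HB Require Import structures.
From mathcomp Require Import all_boot all_order all_algebra.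
From mathcomp Require Import finmap.
From mathcomp Require Import all_classical all_reals all_analysis.
From mathcomp Require Import measurable_realfun ring lra.
Import Order.TTheory GRing.Theory Num.Theory.
Import numFieldNormedType.Exports.
Local Open Scope classical_set_scope.
Local Open Scope ring_scope.

Set Implicit Arguments.
Unset Strict Implicit.
Unset Printing Implicit Defensive.

(* Removing the ground-state particles identifies the canonical state with N
   particles with the law of independent geometric occupation numbers n_k of the
   excited modes, of parameters exp(-beta (eps_k - eps_0)), conditioned on
   M := sum_k n_k <= N; then N_1 = N - M.  Let u_k be the mean of n_k and
   mu := sum_k u_k.  Since (k+1)^2 - 1 >= k^2, expanding u_k in a geometric series
   and comparing Gaussian sums with Gaussian integrals gives
   mu <= V rho_c + o(V); as rho > rho_c, a Chernoff bound at the scale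
   t = lam V^(-2 a1) of the spectral gap shows that the conditioning is
   asymptotically negligible for the Laplace transform of t (M - mu).  The
   unconditioned transform is exp(sum_k (t u_k - ln(1 + (1 - e^(-t)) u_k))), whose
   exponent converges termwise and is dominated by a multiple of
   sum_k |k|^(-4), which is finite in dimension three.  The conditional mean of
   t (M - mu) tends to 0 because 1 - s x <= e^(-s x) bounds it by the Laplace
   transform at small s of either sign. *)

(** The Laplace parameter t is of the order of the spectral gap, so every low mode contributes at
    order one and the geometric law of its occupation stays visible in the limit. Three obstacles
    shape the proof. The functional is centred at the canonical mean, whereas the product formula
    centres at mu; the difference has to vanish after multiplication by t, which is finer than
    convergence of densities because t V tends to infinity. At s = kappa t the exponent is at most C
    kappa^2, so division by kappa leaves an error of order C kappa, with kappa arbitrarily small.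
    Next, the Gaussian comparison covers only modes whose three indices are nonzero. On the faces,
    where some index vanishes, the Bose factor is bounded by a power d^(-(1+r)) with r > 0, which is
    summable in dimension two; alpha_1 < 1/2 leaves room for an r that makes the faces o(V).
    Finally, a mode excited in a direction with alpha_j < alpha_1 has a gap far larger than t and
    drops out; counting the surviving axes, coordinate planes and interior gives the coefficients of
    g1, g2, g3. *)

(** * Sums of nonnegative real families over infinite sets *)

Section RealSums.
Context {R : realType} {T : choiceType}.
Implicit Types (D : set T) (f g b : T -> R) (A : {fset T}).

(** [fine] sends an infinite sum to 0, so the statements that compare this value with partial sums
    carry a [sum_bounded] hypothesis certifying finiteness. *)
Definition rsum D f : R := fine (\esum_(x in D) (f x)%:E).

Lemma ler_fsum_subset A A' f :
  {subset A <= A'} -> (forall x, x \in A' -> 0 <= f x) ->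
  \sum_(x <- A) f x <= \sum_(x <- A') f x.
Proof.
move=> AA' f0; rewrite [leRHS](big_fsetID _ (mem A))/=.
have -> : [fset x in A' | x \in A]%fset = A.
  apply/fsetP => x; rewrite !inE/=; case: (boolP (x \in A)) => xA.
    by rewrite AA'.
  by rewrite andbF.
rewrite lerDl big_seq; apply: sumr_ge0 => x; rewrite !inE/= => /andP[xA' _].
exact: f0.
Qed.

Definition sum_bounded D f (B : R) :=
  forall A, (forall x, x \in A -> D x) -> \sum_(x <- A) f x <= B.

Lemma esum_le_bound D f (B : R) :
  sum_bounded D f B -> (\esum_(x in D) (f x)%:E <= B%:E)%E.
Proof.
move=> h; apply: ge_ereal_sup => _ [A [finA AD] <-].
rewrite fsbig_finite//= sumEFin lee_fin; apply: h => x.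
by rewrite in_fset_set// inE => /AD.
Qed.

Lemma fsum_le_esum D f A : (forall x, x \in A -> D x) ->
  ((\sum_(x <- A) f x)%:E <= \esum_(x in D) (f x)%:E)%E.
Proof.
move=> AD; rewrite -sumEFin; apply: esum_ge; exists [set` A].
  by split; [exact: finite_fset | move=> x /= /AD].
by rewrite fsbig_finite//= set_fsetK.
Qed.

Lemma esum_rsum D f (B : R) : (forall x, D x -> 0 <= f x) ->
  sum_bounded D f B -> \esum_(x in D) (f x)%:E = (rsum D f)%:E.
Proof.
move=> f0 fB; rewrite /rsum fineK// ge0_fin_numE.
  by apply: le_lt_trans (esum_le_bound fB) _; rewrite ltry.
by apply: esum_ge0 => x Dx; rewrite lee_fin f0.
Qed.

Lemma fsum_le_rsum D f (B : R) A : (forall x, D x -> 0 <= f x) ->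
  sum_bounded D f B -> (forall x, x \in A -> D x) ->
  \sum_(x <- A) f x <= rsum D f.
Proof.
by move=> f0 fB AD; rewrite -lee_fin -(esum_rsum f0 fB) fsum_le_esum.
Qed.

Lemma rsum_le_bound D f (B : R) : (forall x, D x -> 0 <= f x) ->
  sum_bounded D f B -> rsum D f <= B.
Proof. by move=> f0 fB; rewrite -lee_fin -(esum_rsum f0 fB) esum_le_bound. Qed.

Lemma sum_bounded_rsum D f (B : R) : (forall x, D x -> 0 <= f x) ->
  sum_bounded D f B -> sum_bounded D f (rsum D f).
Proof. by move=> f0 fB A AD; apply: fsum_le_rsum f0 fB AD. Qed.

Lemma rsum_ge0 D f : (forall x, D x -> 0 <= f x) -> 0 <= rsum D f.
Proof.
by move=> f0; apply: fine_ge0; apply: esum_ge0 => x Dx; rewrite lee_fin f0.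
Qed.

Lemma eq_rsum D f g : (forall x, D x -> f x = g x) -> rsum D f = rsum D g.
Proof. by move=> fg; congr fine; apply: eq_esum => x /fg ->. Qed.

Lemma sum_bounded_le D f g (B : R) : (forall x, D x -> f x <= g x) ->
  sum_bounded D g B -> sum_bounded D f B.
Proof.
move=> fg gB A AD; apply: le_trans (gB A AD).
by rewrite big_seq [leRHS]big_seq; apply: ler_sum => x /AD; exact: fg.
Qed.

Lemma sum_boundedZ D f (B c : R) : 0 <= c ->
  sum_bounded D f B -> sum_bounded D (fun x => c * f x) (c * B).
Proof. by move=> c0 fB A AD; rewrite -mulr_sumr ler_wpM2l// fB. Qed.

Lemma sum_boundedD D f g (B C : R) : sum_bounded D f B -> sum_bounded D g C ->
  sum_bounded D (fun x => f x + g x) (B + C).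
Proof. by move=> fB gC A AD; rewrite big_split lerD// ?fB ?gC. Qed.

Lemma sum_bounded_sub D E f (B : R) : D `<=` E ->
  sum_bounded E f B -> sum_bounded D f B.
Proof. by move=> DE fB A AD; apply: fB => x /AD /DE. Qed.

Lemma ler_rsum D f g (B : R) : (forall x, D x -> 0 <= f x <= g x) ->
  sum_bounded D g B -> rsum D f <= rsum D g.
Proof.
move=> fg gB; have g0 x : D x -> 0 <= g x by move=> /fg /andP[/le_trans]; exact.
apply: rsum_le_bound => [x /fg /andP[]//|].
apply: (@sum_bounded_le _ _ g) => [x /fg /andP[]//|].
exact: sum_bounded_rsum gB.
Qed.

Lemma rsumD D f g (B C : R) :
  (forall x, D x -> 0 <= f x) -> (forall x, D x -> 0 <= g x) ->
  sum_bounded D f B -> sum_bounded D g C ->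
  rsum D (fun x => f x + g x) = rsum D f + rsum D g.
Proof.
move=> f0 g0 fB gC; apply: EFin_inj; rewrite EFinD.
rewrite -(esum_rsum f0 fB) -(esum_rsum g0 gC).
have fg0 x : D x -> 0 <= f x + g x by move=> Dx; rewrite addr_ge0 ?f0 ?g0.
rewrite -(esum_rsum fg0 (sum_boundedD fB gC)).
by rewrite -esumD// => x Dx; rewrite lee_fin ?f0 ?g0.
Qed.

Lemma rsumZ D f (B c : R) : (forall x, D x -> 0 <= f x) ->
  sum_bounded D f B -> 0 <= c -> rsum D (fun x => c * f x) = c * rsum D f.
Proof.
move=> f0 fB c0.
have cf0 x : D x -> 0 <= c * f x by move=> Dx; rewrite mulr_ge0 ?f0.
apply/eqP; rewrite eq_le; apply/andP; split.
  by apply: rsum_le_bound => //; apply: sum_boundedZ => //; exact: sum_bounded_rsum fB.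
have [->|cn0] := eqVneq c 0; first by rewrite mul0r; apply: rsum_ge0 => x _; rewrite mul0r.
have cp : 0 < c by rewrite lt_def cn0.
rewrite mulrC -ler_pdivlMr//; apply: rsum_le_bound => // A AD.
rewrite ler_pdivlMr// mulrC mulr_sumr.
by apply: (fsum_le_rsum cf0 (sum_boundedZ c0 fB)).
Qed.

(* A finite set carrying all but e of the sum of b does so uniformly for the
   functions dominated by b. *)
Lemma rsum_tail D b (B e : R) : (forall x, D x -> 0 <= b x) ->
  sum_bounded D b B -> 0 < e ->
  exists A, (forall x, x \in A -> D x) /\
   forall f, (forall x, D x -> 0 <= f x <= b x) ->
     \sum_(x <- A) f x <= rsum D f <= \sum_(x <- A) f x + e.
Proof.
move=> b0 bB e0.
have [A [AD Ae]] : exists A, (forall x, x \in A -> D x) /\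
    rsum D b - e <= \sum_(x <- A) b x.
  apply: contrapT => /forallNP hN.
  suff : rsum D b <= rsum D b - e by rewrite leNgt ltrBlDr ltrDl e0.
  apply: rsum_le_bound => // A AD; rewrite leNgt; apply/negP => /ltW hA.
  by apply: (hN A).
exists A; split=> // f fb.
have f0 x : D x -> 0 <= f x by move=> /fb /andP[].
have fB : sum_bounded D f B by apply: sum_bounded_le bB => x /fb /andP[].
rewrite (fsum_le_rsum f0 fB AD)/=; apply: rsum_le_bound => // A' A'D.
have AA'D x : x \in (A `|` A')%fset -> D x.
  by rewrite inE => /orP[/AD|/A'D].
have split_sum g : \sum_(x <- (A `|` A')%fset) g x
    = \sum_(x <- A) g x + \sum_(x <- (A' `\` A)%fset) g x.
  rewrite (big_fsetID _ (mem A))/=; congr (_ + _); apply: eq_fbigl => x.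
    by rewrite !inE/=; case: (x \in A) => //=; rewrite ?andbF.
  by rewrite !inE/=; case: (x \in A) => //=; rewrite ?andbT ?andbF.
have le1 : \sum_(x <- A') f x <= \sum_(x <- (A `|` A')%fset) f x.
  apply: ler_fsum_subset => [x xA'|x /AA'D /f0//].
  by rewrite inE xA' orbT.
apply: (le_trans le1); rewrite split_sum lerD2l.
apply: (@le_trans _ _ (\sum_(x <- (A' `\` A)%fset) b x)).
  rewrite big_seq [leRHS]big_seq; apply: ler_sum => x.
  by rewrite inE => /andP[_ /A'D /fb /andP[]].
have := fsum_le_rsum b0 bB AA'D; rewrite split_sum => h.
lra.
Qed.

(** Dominated convergence: one finite set from [rsum_tail] serves all [n] and the limit, and on it
    the termwise convergence is enough. *)
Lemma rsum_dominated_cvg D (F : nat -> T -> R) f b (B : R) :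
  (\forall n \near \oo, forall x, D x -> 0 <= F n x <= b x) ->
  sum_bounded D b B ->
  (forall x, D x -> F n x @[n --> \oo] --> f x) ->
  rsum D (F n) @[n --> \oo] --> rsum D f.
Proof.
move=> Fb bB Ff.
have b0 x : D x -> 0 <= b x.
  move=> Dx; case: Fb => n _ /(_ n (leqnn n) x Dx) /andP[].
  exact: le_trans.
have fb x : D x -> 0 <= f x <= b x.
  move=> Dx; apply/andP; split.
    apply: (cvgr_to_ge (Ff x Dx)).
    by near=> n; have /andP[] : 0 <= F n x <= b x by near: n; apply: filterS Fb => n; exact.
  apply: (cvgr_to_le (Ff x Dx)).
  by near=> n; have /andP[] : 0 <= F n x <= b x by near: n; apply: filterS Fb => n; exact.
apply/cvgrPdist_le => e e0.
have e20 : 0 < e / 2 by rewrite divr_gt0.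
have [A [AD hA]] := rsum_tail b0 bB e20.
have cA : \sum_(x <- A) F n x @[n --> \oo] --> \sum_(x <- A) f x.
  rewrite big_seq; under eq_fun do rewrite big_seq.
  by apply: cvg_big => [|x /AD]; [exact: add_continuous | exact: Ff].
have := hA _ fb => /andP[h1 h2].
near=> n.
have /andP[h3 h4] : \sum_(x <- A) F n x <= rsum D (F n) <= \sum_(x <- A) F n x + e / 2.
  by apply: hA; near: n.
have : `|\sum_(x <- A) f x - \sum_(x <- A) F n x| <= e / 2.
  by near: n; move/cvgrPdist_le : cA; apply.
rewrite !ler_norml => /andP[h5 h6]; apply/andP; split; lra.
Unshelve. all: by end_near. Qed.

End RealSums.

(** * Product formula for sums over occupation numbers *)

Section ProductFormula.
Context {R : realType} {K : choiceType}.
Local Notation occup := {fsfun K -> nat with 0%N}.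
Implicit Types (D : set K) (y : K -> R) (n : occup) (X : {fset K}) (J : nat).

Definition weight y n : R := \prod_(k <- finsupp n) y k ^+ n k.

Definition supported D : set occup := [set n | forall k, k \in finsupp n -> D k].

Lemma weightE y n X : (forall k, k \in finsupp n -> k \in X) ->
  weight y n = \prod_(k <- X) y k ^+ n k.
Proof.
move=> nX; rewrite /weight; apply: big_fset_incl.
  by apply/fsubsetP => k; exact: nX.
by move=> k _ /fsfun_dflt ->; rewrite expr0.
Qed.

Lemma weight_ge0 D y n : (forall k, D k -> 0 <= y k) -> supported D n ->
  0 <= weight y n.
Proof.
move=> y0 nD; rewrite /weight big_seq; apply: prodr_ge0 => k /nD /y0 yk.
exact: exprn_ge0.
Qed.

(** Boxes are indexed by a finite function type so that distributivity of products over sums applies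
    to them. *)
Definition box_occup X J (f : {ffun X -> 'I_J.+1}) : occup :=
  [fsfun k : X => nat_of_ord (f k)].

Definition box X J : {fset occup} :=
  [fset box_occup f | f in {: {ffun X -> 'I_J.+1}}]%fset.

Lemma box_occupE X J (f : {ffun X -> 'I_J.+1}) (k : X) :
  box_occup f (val k) = f k.
Proof. by rewrite /box_occup fsfun_ffun; case: insubP => [u _ /val_inj ->|]//=; rewrite fsvalP. Qed.

Lemma box_occup_out X J (f : {ffun X -> 'I_J.+1}) k :
  k \notin X -> box_occup f k = 0%N.
Proof. by move=> kX; rewrite /box_occup fsfun_ffun insubN. Qed.

Lemma box_occup_inj X J : injective (@box_occup X J).
Proof.
move=> f g fg; apply/ffunP => k; apply: val_inj => /=.
by rewrite -!box_occupE fg.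
Qed.

Lemma finsupp_box X J n : n \in box X J -> forall k, k \in finsupp n -> k \in X.
Proof.
move=> /imfsetP[f _ ->] k; apply: contraTT => kX.
by rewrite mem_finsupp box_occup_out// eqxx.
Qed.

Lemma mem_box X J n : (forall k, k \in finsupp n -> k \in X) ->
  (forall k, k \in X -> (n k <= J)%N) -> n \in box X J.
Proof.
move=> nX nJ; apply/imfsetP; exists [ffun k : X => inord (n (val k))] => //.
apply/fsfunP => k; case: (boolP (k \in X)) => kX.
  have -> : k = val [` kX]%fset by [].
  by rewrite box_occupE ffunE inordK// ltnS; apply: nJ.
rewrite box_occup_out// fsfun_dflt//; apply: contra kX; exact: nX.
Qed.

Lemma sum_weight_box y X J :
  \sum_(n <- box X J) weight y n = \prod_(k <- X) \sum_(j < J.+1) y k ^+ j.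
Proof.
rewrite big_imfset/=; last by move=> f g _ _; exact: box_occup_inj.
rewrite big_seq_fsetE/= bigA_distr_bigA/= [LHS]big_enum/=.
apply: eq_bigr => f _.
rewrite (@weightE _ _ X); last first.
  by move=> k; apply: (@finsupp_box X J); apply/imfsetP; exists f.
by rewrite big_seq_fsetE/=; apply: eq_bigr => k _; rewrite box_occupE.
Qed.

Lemma geometric_sum_le (z : R) J : 0 <= z < 1 ->
  \sum_(j < J.+1) z ^+ j <= (1 - z)^-1.
Proof.
move=> /andP[z0 z1]; have z1' : 0 < 1 - z by rewrite subr_gt0.
rewrite -[leRHS]mul1r ler_pdivlMr// mulrC -opprB mulNr -subrX1 opprB.
by rewrite lerBlDr lerDl exprn_ge0.
Qed.

Lemma cvg_geometric_sum (z : R) : 0 <= z < 1 ->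
  \sum_(j < J.+1) z ^+ j @[J --> \oo] --> (1 - z)^-1.
Proof.
move=> /andP[z0 z1].
have zn : `|z| < 1 by rewrite ger0_norm.
have := @cvg_geometric_series _ 1 z zn; rewrite mul1r -cvg_shiftS.
apply: cvg_trans; apply: near_eq_cvg; near=> J.
by rewrite /series/= big_mkord; apply: eq_bigr => j _; rewrite mul1r.
Unshelve. all: by end_near. Qed.

Lemma prod_inv_expR y X : (forall k, k \in X -> y k < 1) ->
  \prod_(k <- X) (1 - y k)^-1 = expR (\sum_(k <- X) - ln (1 - y k)).
Proof.
move=> y1; rewrite expR_sum big_seq [RHS]big_seq; apply: eq_bigr => k /y1 yk.
by rewrite expRN lnK// posrE subr_gt0.
Qed.

Section Sum.
Variables (D : set K) (y : K -> R) (B : R).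
Hypothesis y01 : forall k, D k -> 0 <= y k < 1.
Hypothesis lnB : sum_bounded D (fun k => - ln (1 - y k)) B.

Let ln_ge0 k : D k -> 0 <= - ln (1 - y k).
Proof.
by move=> /y01 /andP[y0 y1]; rewrite oppr_ge0 ln_le0// lerBlDr lerDl.
Qed.

(** Finitely many occupations lie in one box, with [X] the union of their supports and [J] their
    largest value; there the weights sum to a product of truncated geometric series. *)
Lemma weight_bounded :
  sum_bounded (supported D) (weight y) (expR (rsum D (fun k => - ln (1 - y k)))).
Proof.
move=> A AD.
pose X := (\bigcup_(n <- A) finsupp n)%fset.
have XD k : k \in X -> D k.
  by move=> /bigfcupP[n /andP[nA _]]; exact: AD.
have nX n k : n \in A -> k \in finsupp n -> k \in X.
  by move=> nA kn; apply/bigfcupP; exists n; rewrite ?nA.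
pose J := (\max_(n <- A) \max_(k <- X) n k)%N.
have AB n : n \in A -> n \in box X J.
  move=> nA; apply: mem_box => [k|k kX]; first exact: nX.
  apply: (@leq_trans (\max_(k <- X) n k)%N).
    by apply: (@leq_bigmax_seq _ _ xpredT (fun k : K => n k)).
  by apply: (@leq_bigmax_seq _ _ xpredT (fun n : occup => \max_(k <- X) n k)%N).
have B0 n : n \in box X J -> 0 <= weight y n.
  move=> nB; apply: (@weight_ge0 D) => [k /y01/andP[]//|k kn].
  by apply: XD; exact: finsupp_box nB _ kn.
apply: (le_trans (ler_fsum_subset AB B0)).
rewrite sum_weight_box.
apply: (@le_trans _ _ (\prod_(k <- X) (1 - y k)^-1)).
  rewrite big_seq [leRHS]big_seq; apply: ler_prod => k /XD /y01 yk.
  rewrite geometric_sum_le// andbT; apply: sumr_ge0 => j _.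
  by case/andP: yk => y0 _; rewrite exprn_ge0.
rewrite prod_inv_expR => [|k /XD /y01/andP[]//].
by rewrite ler_expR; exact: (fsum_le_rsum ln_ge0 lnB).
Qed.

(** The lower bound fixes a finite set of modes, lets the height of the box grow, and only then
    takes the supremum over finite sets. *)
Lemma rsum_weight :
  rsum (supported D) (weight y) = expR (rsum D (fun k => - ln (1 - y k))).
Proof.
have w0 n : supported D n -> 0 <= weight y n.
  by apply: weight_ge0 => k /y01/andP[].
apply/eqP; rewrite eq_le; apply/andP; split.
  by apply: rsum_le_bound => //; exact: weight_bounded.
have key X : (forall k, k \in X -> D k) ->
    expR (\sum_(k <- X) - ln (1 - y k)) <= rsum (supported D) (weight y).
  move=> XD; rewrite -prod_inv_expR => [|k /XD /y01/andP[]//].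
  have cX : \prod_(k <- X) (\sum_(j < J.+1) y k ^+ j) @[J --> \oo] -->
      \prod_(k <- X) (1 - y k)^-1.
    rewrite big_seq; under eq_fun do rewrite big_seq.
    apply: cvg_big => [|k /XD /y01 yk]; first exact: mul_continuous.
    exact: cvg_geometric_sum.
  apply: (cvgr_to_le cX); near=> J; rewrite -sum_weight_box.
  apply: (fsum_le_rsum w0 weight_bounded) => n nB k kn.
  by apply: XD; exact: finsupp_box nB _ kn.
have w_gt0 : 0 < rsum (supported D) (weight y).
  apply: lt_le_trans (key fset0 _) => //; exact: expR_gt0.
(* In logarithms, the supremum over finite products becomes the supremum of finite sums that defines
   the right-hand [rsum]. *)
rewrite -[leRHS]lnK ?posrE// ler_expR; apply: rsum_le_bound => // X XD.
by rewrite -[leLHS]expRK ler_ln ?posrE ?expR_gt0//; exact: key.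
Unshelve. all: by end_near. Qed.

End Sum.
End ProductFormula.

(** * Conditioning a weighted sum on M <= N *)

Section Conditioning.
Context {R : realType} {T : choiceType}.
Variables (O : set T) (w : T -> R) (M : T -> nat) (N : nat).
Hypothesis w0 : forall n, O n -> 0 <= w n.

Definition tilt (s : R) (n : T) : R := w n * expR (- (s * (M n)%:R)).

Definition cond : set T := O `&` [set n | (M n <= N)%N].

Let tilt_ge0 s n : O n -> 0 <= tilt s n.
Proof. by move=> On; rewrite mulr_ge0 ?expR_ge0 ?w0. Qed.

Lemma cond_le s (B : R) : sum_bounded O (tilt s) B ->
  rsum cond (tilt s) <= rsum O (tilt s).
Proof.
move=> tB; apply: rsum_le_bound => [n []/tilt_ge0//|].
apply: (@sum_bounded_sub _ _ _ O); first by move=> n [].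
by apply: sum_bounded_rsum tB => n; exact: tilt_ge0.
Qed.

(* Chernoff: on M > N the tilt is at most exp(-(s+th)N) times the tilt at -th. *)
Lemma cond_ge s th (B C : R) : 0 <= s + th ->
  sum_bounded O (tilt s) B -> sum_bounded O (tilt (- th)) C ->
  rsum O (tilt s) - expR (- ((s + th) * N%:R)) * rsum O (tilt (- th))
    <= rsum cond (tilt s).
Proof.
move=> sth sB thC; rewrite lerBlDr.
pose g n := if (M n <= N)%N then tilt s n else 0.
have g0 n : O n -> 0 <= g n by rewrite /g; case: ifP => // _ /tilt_ge0.
have gB : sum_bounded O g B.
  apply: sum_bounded_le sB => n On; rewrite /g; case: ifP => // _.
  exact: tilt_ge0.
have <- : rsum O g = rsum cond (tilt s).
  rewrite /rsum /cond esum_mkcondr; congr fine; apply: eq_esum => n On.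
  rewrite /g (_ : (n \in _) = (M n <= N)%N); first by case: ifP.
  by apply/idP/idP; rewrite inE.
have e0 : 0 <= expR (- ((s + th) * N%:R)) := expR_ge0 _.
rewrite -(rsumZ (@tilt_ge0 (- th)) thC e0).
have h0 n : O n -> 0 <= expR (- ((s + th) * N%:R)) * tilt (- th) n.
  by move=> On; rewrite mulr_ge0// tilt_ge0.
rewrite -(rsumD g0 h0 gB (sum_boundedZ e0 thC)).
apply: ler_rsum (sum_boundedD gB (sum_boundedZ e0 thC)) => n On.
rewrite tilt_ge0//= /g; case: ifP => [_|/negbT]; first by rewrite lerDl h0.
rewrite -ltnNge => NM; rewrite add0r /tilt mulrCA ler_wpM2l ?w0//.
rewrite -expRD ler_expR.
have : N%:R <= (M n)%:R :> R by rewrite ler_nat ltnW.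
nra.
Qed.

(** Sums [1 + z <= expR z] at z = s (mu - M) against the weights. [rsumD] and [rsumZ] want
    nonnegative terms, so each sign of [s] moves different terms across the inequality. *)
Lemma cond_mean s mu (B C : R) : 0 <= mu ->
  sum_bounded O w B -> sum_bounded O (tilt s) C ->
  (1 + s * mu) * rsum cond w - s * rsum cond (fun n => (M n)%:R * w n)
    <= expR (s * mu) * rsum cond (tilt s).
Proof.
move=> mu0 wB tC.
have cw0 n : cond n -> 0 <= w n by case=> /w0.
have ct0 n : cond n -> 0 <= tilt s n by case=> /tilt_ge0.
have cwB : sum_bounded cond w B by apply: sum_bounded_sub wB => n [].
have ctC : sum_bounded cond (tilt s) C by apply: sum_bounded_sub tC => n [].
have cM0 n : cond n -> 0 <= (M n)%:R * w n by move=> /cw0 ?; rewrite mulr_ge0.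
have cMB : sum_bounded cond (fun n => (M n)%:R * w n) (N%:R * B).
  apply: sum_bounded_le (sum_boundedZ (ler0n R N) cwB) => n cn.
  by rewrite ler_wpM2r ?cw0// ler_nat; case: cn.
have pt n : cond n ->
    (1 + s * mu) * w n - s * ((M n)%:R * w n) <= expR (s * mu) * tilt s n.
  move=> cn; rewrite /tilt [leRHS]mulrCA -expRD.
  have := expR_ge1Dx (s * mu - s * (M n)%:R); have := cw0 _ cn; nra.
have e0 : 0 <= expR (s * mu) := expR_ge0 _.
rewrite -(rsumZ ct0 ctC e0).
have ect0 n : cond n -> 0 <= expR (s * mu) * tilt s n.
  by move=> /ct0 ?; rewrite mulr_ge0.
have ectC := sum_boundedZ e0 ctC.
have [s0|s0] := leP 0 s.
  have a0 : 0 <= 1 + s * mu by nra.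
  rewrite lerBlDr -(rsumZ cw0 cwB a0) -(rsumZ cM0 cMB s0).
  have sM0 n : cond n -> 0 <= s * ((M n)%:R * w n).
    by move=> /cM0 ?; rewrite mulr_ge0.
  have sMB := sum_boundedZ s0 cMB.
  rewrite -(rsumD ect0 sM0 ectC sMB).
  apply: ler_rsum (sum_boundedD ectC sMB) => n cn.
  by rewrite mulr_ge0 ?cw0//= -lerBlDr pt.
have s0' : 0 <= - s by lra.
have a0 : 0 <= - s * mu by nra.
rewrite [X in X <= _](_ : _ = rsum cond w
    + - s * rsum cond (fun n => (M n)%:R * w n) - - s * mu * rsum cond w);
  last by ring.
rewrite lerBlDr -(rsumZ cM0 cMB s0') -(rsumZ cw0 cwB a0).
have sM0 n : cond n -> 0 <= - s * ((M n)%:R * w n).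
  by move=> /cM0 ?; rewrite mulr_ge0.
have sMB := sum_boundedZ s0' cMB.
have sw0 n : cond n -> 0 <= - s * mu * w n.
  by move=> /cw0 ?; rewrite mulr_ge0.
have swB := sum_boundedZ a0 cwB.
rewrite -(rsumD cw0 sM0 cwB sMB) -(rsumD ect0 sw0 ectC swB).
apply: ler_rsum (sum_boundedD ectC swB) => n cn.
rewrite addr_ge0 ?cw0 ?sM0//=.
have := pt n cn; lra.
Qed.

End Conditioning.

(** * Elimination of the ground-state particles *)

Section CanonicalReduction.
Context {R : realType}.

Definition excited : set mode := [set k | k <> ground_mode].

Lemma occ_totalE (n : occ) (X : {fset mode}) :
  (finsupp n `<=` X)%fset -> occ_total n = (\sum_(k <- X) n k)%N.
Proof.
by move=> nX; apply: big_fset_incl => // k _ /fsfun_dflt.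
Qed.

Variables (beta a1 a2 a3 V : R) (N : nat).

(** The factor [beta] is included, so that [expR (- gap k)] is the parameter of the geometric law of
    mode [k]. *)
Definition gap (k : mode) : R :=
  beta * (eps a1 a2 a3 V k - eps a1 a2 a3 V ground_mode).

Let x k := expR (- gap k).

Lemma energyE (n : occ) (X : {fset mode}) : (finsupp n `<=` X)%fset ->
  energy a1 a2 a3 V n = \sum_(k <- X) (n k)%:R * eps a1 a2 a3 V k.
Proof.
by move=> nX; apply: big_fset_incl => // k _ /fsfun_dflt ->; rewrite mul0r.
Qed.

(** Puts the missing particles into the ground state; the truncated subtraction is exact when
    [occ_total n <= N], which is the domain of the bijection [fill_bij]. *)
Let fill (n : occ) : occ := [fsfun n with ground_mode |-> (N - occ_total n)%N].

Let ground_notin (n : occ) : supported excited n -> ground_mode \notin finsupp n.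
Proof. by move=> nE; apply/negP => /nE. Qed.

Let finsupp_fill n : (finsupp (fill n) `<=` ground_mode |` finsupp n)%fset.
Proof.
apply/fsubsetP => k; rewrite mem_finsupp fsfun_withE !inE.
by case: (eqVneq _ ground_mode) => //= _; rewrite mem_finsupp.
Qed.

Let fill_ground n : fill n ground_mode = (N - occ_total n)%N.
Proof. by rewrite fsfun_withE eqxx. Qed.

Let fill_finsupp n k : supported excited n -> k \in finsupp n -> fill n k = n k.
Proof.
by move=> nE kn; rewrite fsfun_withE; case: (eqVneq _ ground_mode) => // kg; have := nE k kn; rewrite kg.
Qed.

Let cfg := cond (supported excited) occ_total N.

Let fill_bij : set_bij cfg (configs N) fill.
Proof.
split.
- move=> n [nE nN]; rewrite /configs/= (occ_totalE (finsupp_fill n)).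
  rewrite big_fsetU1 ?ground_notin//= fill_ground big_seq.
  under eq_bigr => k kn do rewrite fill_finsupp//.
  by rewrite -big_seq subnK.
- move=> n m; rewrite !inE => -[nE _] [mE _] nm; apply/fsfunP => k.
  have [->|/eqP kg] := eqVneq k ground_mode.
    by rewrite !fsfun_dflt// ground_notin.
  have := congr1 (fun f : occ => f k) nm.
  by rewrite !fsfun_withE; case: (eqVneq _ ground_mode).
- move=> n nN; exists [fsfun n with ground_mode |-> 0%N].
    have sE : supported excited [fsfun n with ground_mode |-> 0%N].
      move=> k; rewrite mem_finsupp fsfun_withE.
      by case: (eqVneq k ground_mode) => // /eqP.
    split=> //=; rewrite -nN.
    rewrite (@occ_totalE _ (ground_mode |` finsupp n)%fset); last first.
      apply/fsubsetP => k; rewrite mem_finsupp fsfun_withE !inE.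
      by case: (eqVneq _ ground_mode) => //= _; rewrite mem_finsupp.
    rewrite (@occ_totalE n (ground_mode |` finsupp n)%fset) ?fsubsetU1//.
    by apply: leq_sum => k _; rewrite fsfun_withE; case: (eqVneq _ ground_mode).
  apply/fsfunP => k; rewrite fsfun_withE; case: (eqVneq _ ground_mode) => [->|kg]; last first.
    by rewrite fsfun_withE (negbTE kg).
  rewrite -nN.
  rewrite (@occ_totalE [fsfun n with ground_mode |-> 0%N] (ground_mode |` finsupp n)%fset); last first.
    apply/fsubsetP => k'; rewrite mem_finsupp fsfun_withE !inE.
    by case: (eqVneq _ ground_mode) => //= _; rewrite mem_finsupp.
  rewrite (@occ_totalE n (ground_mode |` finsupp n)%fset) ?fsubsetU1//.
  have gX : ground_mode \in (ground_mode |` finsupp n)%fset by rewrite !inE eqxx.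
  rewrite !(big_fsetD1 _ gX)/= fsfun_withE eqxx add0n.
  rewrite [X in (_ - X)%N](_ : _ = \sum_(i <- ((ground_mode |` finsupp n) `\ ground_mode)%fset) n i)%N ?addnK//.
  rewrite big_seq [RHS]big_seq; apply: eq_bigr => k'; rewrite !inE => /andP[k'g _].
  by rewrite fsfun_withE (negbTE k'g).
Qed.

(** All N particles carry the ground energy, which factors out; an excited particle adds only its
    gap. *)
Let boltz_fill n : cfg n -> boltz beta a1 a2 a3 V (fill n)
  = expR (- (beta * (N%:R * eps a1 a2 a3 V ground_mode))) * weight x n.
Proof.
move=> [nE nN]; rewrite /boltz (energyE (finsupp_fill n)).
rewrite big_fsetU1 ?ground_notin//= fill_ground big_seq.
under eq_bigr => k kn do rewrite fill_finsupp//.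
rewrite -big_seq /weight.
under [in RHS]eq_bigr => k _ do rewrite /x -expRM_natl.
rewrite -expR_sum -expRD; congr expR.
rewrite natrB// [in LHS]/occ_total natr_sum.
under [in RHS]eq_bigr => k _ do rewrite mulrN /gap mulrCA mulrBr.
rewrite sumrN -mulr_sumr sumrB -mulr_suml; ring.
Qed.

Lemma rsum_configs (phi : nat -> R) (B : R) : (forall j, 0 <= phi j) ->
  sum_bounded (supported excited) (weight x) B ->
  rsum (configs N) (fun n => phi (N1 n) * boltz beta a1 a2 a3 V n) =
  expR (- (beta * (N%:R * eps a1 a2 a3 V ground_mode))) *
   rsum cfg (fun n => phi (N - occ_total n)%N * weight x n).
Proof.
move=> phi0 wB; rewrite {1}/rsum (reindex_esum _ _ _ _ fill_bij) -/(rsum _ _).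
have cw0 n : cfg n -> 0 <= weight x n.
  by case=> nE _; apply: weight_ge0 nE => k _; exact: expR_ge0.
(* The argument of [phi] never exceeds N, so the sum of its first N + 1 values is a uniform
   bound. *)
pose C := \sum_(j < N.+1) phi j.
have C0 : 0 <= C by apply: sumr_ge0.
have pC n : phi (N - occ_total n)%N <= C.
  have jN : (N - occ_total n < N.+1)%N by rewrite ltnS leq_subr.
  by rewrite /C (bigD1 (Ordinal jN))//= lerDl sumr_ge0.
have cwB : sum_bounded cfg (weight x) B by apply: sum_bounded_sub wB => n [].
have pB : sum_bounded cfg (fun n => phi (N - occ_total n)%N * weight x n) (C * B).
  apply: sum_bounded_le (sum_boundedZ C0 cwB) => n cn.
  by rewrite ler_wpM2r// cw0.
rewrite -(rsumZ _ pB) ?expR_ge0//; last by move=> n /cw0 ?; rewrite mulr_ge0.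
by apply: eq_rsum => n cn; rewrite boltz_fill// /N1 fill_ground mulrCA.
Qed.

Lemma canon_expectE (phi : nat -> R) (B : R) : (forall j, 0 <= phi j) ->
  sum_bounded (supported excited) (weight x) B ->
  canon_expect beta a1 a2 a3 V N (fun n => phi (N1 n)) =
  rsum cfg (fun n => phi (N - occ_total n)%N * weight x n) /
  rsum cfg (weight x).
Proof.
move=> phi0 wB; rewrite /canon_expect /Zcan.
rewrite -/(rsum (configs N) (fun n => phi (N1 n) * boltz beta a1 a2 a3 V n)).
rewrite -/(rsum (configs N) (fun n => boltz beta a1 a2 a3 V n)).
rewrite (rsum_configs phi0 wB).
have := @rsum_configs (fun=> 1) B (fun=> ler01) wB.
rewrite (eq_rsum (f := fun n => 1 * _) (g := fun n => boltz beta a1 a2 a3 V n)).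
  move=> ->; rewrite (eq_rsum (f := fun n => 1 * _) (g := weight x)).
    by rewrite -mulf_div divff ?mul1r// gt_eqF ?expR_gt0.
  by move=> n _; rewrite mul1r.
by move=> n _; rewrite mul1r.
Qed.

End CanonicalReduction.

(** * Elementary bounds on exponentials, logarithms and Bose factors *)

Section ElementaryBounds.
Context {R : realType}.
Implicit Types r s z d u : R.

(** From e^(-r) >= 1 - r, since (1 - r) (1 + r + 2 r^2) = 1 + r^2 (1 - 2 r) >= 1. *)
Lemma expR_le_quad r : r <= 1 / 2 -> expR r <= 1 + r + 2 * r ^+ 2.
Proof.
move=> r2.
have h := expR_ge1Dx (- r); have e0 := expR_gt0 r.
have : expR r * expR (- r) = 1 by rewrite -expRD subrr expR0.
nra.
Qed.

(** ln (1 + y) <= y at y = 1 / (1 + z) - 1 gives ln (1 + z) >= z - z^2 / (1 + z), and 1 + z >=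
    1/2. *)
Lemma ln1D_ge z : - (1 / 2) <= z -> z - 2 * z ^+ 2 <= ln (1 + z).
Proof.
move=> z2; have z1 : 0 < 1 + z by lra.
have h := @le_ln1Dx R ((1 + z)^-1 - 1).
have iv : (1 + z)^-1 * (1 + z) = 1 by rewrite mulVf// gt_eqF.
have i0 : 0 < (1 + z)^-1 by rewrite invr_gt0.
move: h; rewrite (_ : 1 + ((1 + z)^-1 - 1) = (1 + z)^-1); last by ring.
rewrite lnV ?posrE//.
have -> : -1 < (1 + z)^-1 - 1 by lra.
move=> /(_ isT); nra.
Qed.

(** For [d > 0], the mean of a geometric variable of parameter [expR (- d)]. *)
Definition bose (d : R) : R := (expR d - 1)^-1.

Lemma expRB1_gt0 d : 0 < d -> 0 < expR d - 1.
Proof. by move=> d0; rewrite subr_gt0 expR_gt1. Qed.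

Lemma bose_gt0 d : 0 < d -> 0 < bose d.
Proof. by move=> d0; rewrite invr_gt0 expRB1_gt0. Qed.

Lemma bose_le_inv d : 0 < d -> bose d <= d^-1.
Proof.
move=> d0; rewrite lef_pV2 ?posrE ?expRB1_gt0//.
have := expR_ge1Dx d; lra.
Qed.

Lemma bose_le_inv2 d : 0 < d -> bose d <= 2 * d ^- 2.
Proof.
move=> d0; have := @expR_ge1Dxn R d 1 (ltW d0).
rewrite (_ : 2`! = 2)%N// => h.
rewrite -[2]invrK -invfM lef_pV2 ?posrE ?expRB1_gt0 ?mulr_gt0 ?exprn_gt0//.
rewrite mulrC; lra.
Qed.

Lemma bose_anti d1 d2 : 0 < d1 -> d1 <= d2 -> bose d2 <= bose d1.
Proof.
move=> d10 d12; have d20 := lt_le_trans d10 d12.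
by rewrite lef_pV2 ?posrE ?expRB1_gt0// lerB// ler_expR.
Qed.

(** For a geometric variable n of mean [u] this is ln E exp(-s (n - u)). *)
Definition logmgf s u : R := s * u - ln (1 + (1 - expR (- s)) * u).

(** Only [s < 0] is at stake: there e^(-s) - 1 <= -2 s because |s| <= 1/2, while [bose d] is at most
    1/d, hence at most 1 / (-4 s). *)
Lemma logmgf_z s d : 0 < d -> `|s| <= 1 / 2 -> - (4 * s) <= d ->
  - (1 / 2) <= (1 - expR (- s)) * bose d.
Proof.
move=> d0 s2 sd; have u0 := bose_gt0 d0.
have [s0|s0] := leP 0 s.
  have : expR (- s) <= 1 by rewrite expR_le1 oppr_le0.
  nra.
have h : expR (- s) <= 1 + - s + 2 * (- s) ^+ 2.
  by apply: expR_le_quad; move: s2; rewrite ler_norml => /andP[]; lra.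
have ub := bose_le_inv d0.
have : (d^-1) * (- (4 * s)) <= 1.
  by rewrite mulrC ler_pdivrMr// mul1r.
have i0 : 0 < d^-1 by rewrite invr_gt0.
move: s2; rewrite ler_norml => /andP[s2 _]; nra.
Qed.

Lemma logmgf_ge0 s d : 0 < d -> `|s| <= 1 / 2 -> - (4 * s) <= d ->
  0 <= logmgf s (bose d).
Proof.
move=> d0 s2 sd; have z2 := logmgf_z d0 s2 sd; rewrite /logmgf subr_ge0.
apply: (@le_trans _ _ ((1 - expR (- s)) * bose d)); first by apply: le_ln1Dx; lra.
by rewrite ler_wpM2r ?(ltW (bose_gt0 d0))//; have := expR_ge1Dx (- s); lra.
Qed.

(** The 12 is 8 + 4. With z = (1 - e^(-s)) u, -ln (1 + z) <= -z + 2 z^2 and z^2 <= 4 s^2 / d^2;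
    moreover (s - 1 + e^(-s)) u <= 2 s^2 u <= 4 s^2 / d^2 by [bose_le_inv2]. *)
Lemma logmgf_le s d : 0 < d -> `|s| <= 1 / 2 -> - (4 * s) <= d ->
  logmgf s (bose d) <= 12 * s ^+ 2 * d ^- 2.
Proof.
move=> d0 s2 sd; have z2 := logmgf_z d0 s2 sd; rewrite /logmgf.
have := ln1D_ge z2.
have u0 := bose_gt0 d0; have u1 := bose_le_inv d0; have u2 := bose_le_inv2 d0.
have i0 : 0 < d^-1 by rewrite invr_gt0.
rewrite -exprVn in u2 *.
set u := bose d in u0 u1 u2 z2 *; set i := d^-1 in i0 u1 u2 *.
have h1 := expR_ge1Dx (- s).
move: s2; rewrite ler_norml => /andP[s21 s22].
have h2 : expR (- s) <= 1 + - s + 2 * (- s) ^+ 2 by apply: expR_le_quad; lra.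
set e := expR (- s) in h1 h2 z2 *.
have uu : u ^+ 2 <= i ^+ 2 by rewrite lerXn2r// nnegrE ltW.
have ee : (1 - e) ^+ 2 <= 4 * s ^+ 2.
  rewrite -subr_le0 (_ : _ - _ = (1 - e - 2 * s) * (1 - e + 2 * s)); last by ring.
  have [s0|s0] := leP 0 s.
    by rewrite mulr_le0_ge0//; nra.
  by rewrite mulr_ge0_le0//; nra.
have zz : ((1 - e) * u) ^+ 2 <= 4 * s ^+ 2 * i ^+ 2.
  by rewrite exprMn ler_pM ?sqr_ge0.
have su : (s - (1 - e)) * u <= 4 * s ^+ 2 * i ^+ 2.
  apply: (@le_trans _ _ (2 * s ^+ 2 * u)); first by nra.
  by have := sqr_ge0 s; nra.
lra.
Qed.

End ElementaryBounds.

(** * Arithmetic of normalised tilted sums *)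

Section MarkovArithmetic.
Context {R : realFieldType}.

(** Throughout, [z] is a conditioned tilted sum, [l] and [l0] are the tilted and untilted full sums,
    [e] is exp(s mu), and [h] is the exponential of the summed [logmgf]. *)
Lemma tilted_ratio_le (z l l0 e h : R) : 0 < l0 -> 0 <= e ->
  l * e = l0 * h -> z <= l -> z * e / l0 <= h.
Proof.
by move=> l00 e0 le zl; rewrite ler_pdivrMr// [leRHS]mulrC -le ler_wpM2r.
Qed.

(** [l'], [e'] and [h'] belong to the tilt at [- th]; [c] and [c'] are the Chernoff factor before
    and after centring at mu. *)
Lemma tilted_ratio_ge (z l l0 e h l' e' h' c c' : R) : 0 < l0 -> 0 <= e ->
  l * e = l0 * h -> l' * e' = l0 * h' -> c' * e' = c * e ->
  l - c * l' <= z -> h - c' * h' <= z * e / l0.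
Proof.
move=> l00 e0 le le' ce zl; rewrite ler_pdivlMr//.
have -> : (h - c' * h') * l0 = (l - c * l') * e.
  have -> : (h - c' * h') * l0 = l0 * h - c' * (l0 * h') by ring.
  rewrite -le -le'; have -> : c' * (l' * e') = (c' * e') * l' by ring.
  rewrite ce; ring.
exact: ler_wpM2r.
Qed.

Lemma tilted_mean_le (z0 zm z l0 e h s mu : R) : 0 < l0 -> 0 < z0 ->
  (1 + s * mu) * z0 - s * zm <= e * z -> z * e / l0 <= h ->
  1 - s * (zm / z0 - mu) <= h / (z0 / l0).
Proof.
move=> l00 z00 h1; rewrite ler_pdivrMr// => h2.
rewrite invf_div mulrA ler_pdivlMr//; apply: le_trans h2; rewrite [leRHS]mulrC.
have -> // : (1 - s * (zm / z0 - mu)) * z0 = (1 + s * mu) * z0 - s * zm.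
by field; rewrite gt_eqF.
Qed.

End MarkovArithmetic.

(** * Independent geometric occupation numbers *)

Section GeometricOccupations.
Context {R : realType}.
Variables (D : set mode) (d : mode -> R) (B C : R).
Hypothesis d0 : forall k, D k -> 0 < d k.
Hypothesis uB : sum_bounded D (fun k => bose (d k)) B.
Hypothesis dC : sum_bounded D (fun k => d k ^- 2) C.

Local Notation x := (fun k => expR (- d k)).
Local Notation w := (weight x).
Local Notation O := (supported D).
Local Notation L s := (rsum O (tilt w occ_total s)).
Local Notation mu := (rsum D (fun k => bose (d k))).
Local Notation E s := (rsum D (fun k => logmgf s (bose (d k)))).

(** A negative [s] must stay within a quarter of every gap: this keeps [expR (- d k - s)] below 1
    and the argument of the logarithm in [logmgf] at least 1/2. *)
Definition admissible (s : R) :=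
  `|s| <= 1 / 2 /\ forall k, D k -> - (4 * s) <= d k.

Lemma admissible0 : admissible 0.
Proof. by split=> [|k /d0 /ltW]; rewrite ?normr0 ?mulr0 ?oppr0//; lra. Qed.

(** Tilting by the particle number multiplies every fugacity by e^(-s), so the product formula
    applies to tilted sums as well. *)
Lemma tilt_weight s n : tilt w occ_total s n
  = weight (fun k => expR (- d k) * expR (- s)) n.
Proof.
rewrite /tilt /weight /occ_total.
under [RHS]eq_bigr do rewrite exprMn.
rewrite big_split/=; congr (_ * _).
rewrite natr_sum mulr_sumr -sumrN expR_sum; apply: eq_bigr => k _.
by rewrite -expRM_natl mulrN mulrC.
Qed.

Lemma ln_shift s k : admissible s -> D k ->
  - ln (1 - expR (- d k) * expR (- s)) + s * bose (d k)
  = logmgf s (bose (d k)) + - ln (1 - expR (- d k)).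
Proof.
move=> [s2 sd] Dk; have dk := d0 Dk; have z := logmgf_z dk s2 (sd _ Dk).
have x1 : 0 < 1 - expR (- d k) by rewrite subr_gt0 expR_lt1 oppr_lt0.
rewrite /logmgf.
have -> : 1 - expR (- d k) * expR (- s)
    = (1 - expR (- d k)) * (1 + (1 - expR (- s)) * bose (d k)).
  have eb : (1 - expR (- d k)) * bose (d k) = expR (- d k).
    have ed := expRB1_gt0 dk.
    apply: (mulIf (lt0r_neq0 ed)); rewrite -mulrA mulVf ?lt0r_neq0// mulr1 mulrBr.
    by rewrite -expRD addNr expR0 mulr1.
  rewrite mulrDr mulr1 mulrCA eb; ring.
rewrite lnM ?posrE//; last by lra.
lra.
Qed.

Lemma fugacity_range s k : admissible s -> D k ->
  0 <= expR (- d k) * expR (- s) < 1.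
Proof.
move=> [_ sd] Dk; rewrite -expRD expR_ge0 expR_lt1.
have := d0 Dk; have := sd _ Dk; lra.
Qed.

Let ln_fug_ge0 s k : admissible s -> D k ->
  0 <= - ln (1 - expR (- d k) * expR (- s)).
Proof.
move=> sa Dk; have /andP[y0 y1] := fugacity_range sa Dk.
by rewrite oppr_ge0 ln_le0// lerBlDr lerDl.
Qed.

Let ln_x_ge0 k : D k -> 0 <= - ln (1 - expR (- d k)).
Proof.
by move=> Dk; have := ln_fug_ge0 admissible0 Dk; rewrite oppr0 expR0 mulr1.
Qed.

(** -ln (1 - x) = ln (1 + u) <= u with u the mean occupation, so summable means make the partition
    function finite. *)
Let ln_x_bound : sum_bounded D (fun k => - ln (1 - expR (- d k))) B.
Proof.
apply: sum_bounded_le uB => k Dk; have dk := d0 Dk.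
have x1 : 0 < 1 - expR (- d k) by rewrite subr_gt0 expR_lt1 oppr_lt0.
rewrite -lnV ?posrE//.
have -> : (1 - expR (- d k))^-1 = 1 + bose (d k).
  have ed := expRB1_gt0 dk.
  have e1 : expR (- d k) * expR (d k) = 1 by rewrite -expRD addNr expR0.
  apply: (mulIf (lt0r_neq0 x1)); rewrite mulVf ?lt0r_neq0//.
  apply: (mulIf (lt0r_neq0 ed)).
  have -> : (1 + bose (d k)) * (1 - expR (- d k)) * (expR (d k) - 1) =
    (1 - expR (- d k)) * (expR (d k) - 1 + bose (d k) * (expR (d k) - 1)) by ring.
  rewrite mulVf ?lt0r_neq0// subrK; lra.
by apply: le_ln1Dx; have := bose_gt0 dk; lra.
Qed.

Lemma logmgf_bounded s : admissible s ->
  sum_bounded D (fun k => logmgf s (bose (d k))) (12 * s ^+ 2 * C).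
Proof.
move=> [s2 sd]; have c0 : 0 <= 12 * s ^+ 2 by rewrite mulr_ge0 ?sqr_ge0.
apply: sum_bounded_le (sum_boundedZ c0 dC) => k Dk.
by apply: logmgf_le; [exact: d0|exact: s2|exact: sd].
Qed.

Lemma rsum_logmgf_le s : admissible s -> E s <= 12 * s ^+ 2 * C.
Proof.
move=> sa; apply: rsum_le_bound (logmgf_bounded sa) => k Dk.
by case: sa => s2 sd; apply: logmgf_ge0; [exact: d0|exact: s2|exact: sd].
Qed.

Let u_ge0 k : D k -> 0 <= bose (d k).
Proof. by move=> /d0 /bose_gt0 /ltW. Qed.

Lemma mean_ge0 : 0 <= mu.
Proof. exact: rsum_ge0. Qed.

Let fug_bound s : admissible s ->
  sum_bounded D (fun k => - ln (1 - expR (- d k) * expR (- s)))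
    (12 * s ^+ 2 * C + B + `|s| * B).
Proof.
move=> sa.
apply: sum_bounded_le (sum_boundedD (sum_boundedD (logmgf_bounded sa) ln_x_bound)
  (sum_boundedZ (normr_ge0 s) uB)) => k Dk /=.
have := ln_shift sa Dk; have := u_ge0 Dk; have := ler_norm (- s).
rewrite normrN; nra.
Qed.

Lemma tilt_bounded s : admissible s ->
  sum_bounded O (tilt w occ_total s) (L s).
Proof.
move=> sa; have fr k (Dk : D k) := fugacity_range sa Dk.
have wB := weight_bounded fr (fug_bound sa).
apply: (@sum_bounded_rsum _ _ _ _ (expR (rsum D (fun k => - ln (1 - expR (- d k) * expR (- s)))))).
  move=> n On; rewrite mulr_ge0 ?expR_ge0//.
  by apply: weight_ge0 On => k _; exact: expR_ge0.
by apply: sum_bounded_le wB => n _; rewrite tilt_weight.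
Qed.

Let L_expR s : admissible s ->
  L s = expR (rsum D (fun k => - ln (1 - expR (- d k) * expR (- s)))).
Proof.
move=> sa; have fr k (Dk : D k) := fugacity_range sa Dk.
rewrite -(rsum_weight fr (fug_bound sa)).
by apply: eq_rsum => n _; rewrite tilt_weight.
Qed.

(** [ln_shift] summed over the modes and exponentiated through the product formula. For [s < 0] the
    term [s * mu] changes side to keep all summands nonnegative. *)
Lemma tilt_ratio s : admissible s -> L s * expR (s * mu) = L 0 * expR (E s).
Proof.
move=> sa; rewrite !L_expR//; last exact: admissible0.
rewrite -[LHS]expRD -[RHS]expRD; apply: congr1.
rewrite (@eq_rsum _ _ _ (fun k => - ln (1 - expR (- d k) * expR (- 0)))
  (fun k => - ln (1 - expR (- d k)))); last first.
  by move=> k _; rewrite oppr0 expR0 mulr1.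
have h0 k : D k -> 0 <= logmgf s (bose (d k)).
  by move=> Dk; case: sa => s2 sd; apply: logmgf_ge0; [exact: d0|exact: s2|exact: sd].
rewrite [RHS]addrC -(rsumD h0 ln_x_ge0 (logmgf_bounded sa) ln_x_bound).
have [s0|s0] := leP 0 s.
  rewrite -(rsumZ u_ge0 uB s0).
  have su0 k : D k -> 0 <= s * bose (d k) by move=> /u_ge0 ?; rewrite mulr_ge0.
  rewrite -(rsumD (fun k => @ln_fug_ge0 s k sa) su0 (fug_bound sa)
    (sum_boundedZ s0 uB)).
  by apply: eq_rsum => k Dk; exact: ln_shift.
have s0' : 0 <= - s by lra.
suff : rsum D (fun k => - ln (1 - expR (- d k) * expR (- s))) =
  rsum D (fun k => logmgf s (bose (d k)) + - ln (1 - expR (- d k))) + - s * mu by lra.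
rewrite -(rsumZ u_ge0 uB s0').
have su0 k : D k -> 0 <= - s * bose (d k) by move=> /u_ge0 ?; rewrite mulr_ge0.
have hl0 k : D k -> 0 <= logmgf s (bose (d k)) + - ln (1 - expR (- d k)).
  by move=> Dk; rewrite addr_ge0 ?h0 ?ln_x_ge0.
rewrite -(rsumD hl0 su0 (sum_boundedD (logmgf_bounded sa) ln_x_bound)
  (sum_boundedZ s0' uB)).
apply: eq_rsum => k Dk; have := ln_shift sa Dk; lra.
Qed.

Lemma rsum_tilt0_gt0 : 0 < L 0.
Proof. by rewrite L_expR ?expR_gt0//; exact: admissible0. Qed.

Variable N : nat.
Local Notation Cn := (cond O occ_total N).
Local Notation Z s := (rsum Cn (tilt w occ_total s)).

Let w0 n : O n -> 0 <= w n.
Proof. by apply: weight_ge0 => k _; exact: expR_ge0. Qed.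

Lemma rsum_tilt0 (S : set occ) : rsum S (tilt w occ_total 0) = rsum S w.
Proof. by apply: eq_rsum => n _; rewrite /tilt mul0r oppr0 expR0 mulr1. Qed.

Lemma weight_bound : sum_bounded O w (L 0).
Proof.
apply: sum_bounded_le (tilt_bounded admissible0) => n _.
by rewrite /tilt mul0r oppr0 expR0 mulr1.
Qed.

Lemma cond_mgf_le s : admissible s -> Z s * expR (s * mu) / L 0 <= expR (E s).
Proof.
move=> sa; apply: (tilted_ratio_le rsum_tilt0_gt0 (expR_ge0 _) (tilt_ratio sa)).
by apply: cond_le (tilt_bounded sa); exact: w0.
Qed.

Lemma cond_mgf_ge s th : 0 <= s + th -> admissible s -> admissible (- th) ->
  expR (E s) - expR (- ((s + th) * (N%:R - mu))) * expR (E (- th))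
    <= Z s * expR (s * mu) / L 0.
Proof.
move=> sth sa tha.
apply: (tilted_ratio_ge rsum_tilt0_gt0 (expR_ge0 _) (tilt_ratio sa) (tilt_ratio tha) _
  (cond_ge N w0 sth (tilt_bounded sa) (tilt_bounded tha))).
rewrite -[LHS]expRD -[RHS]expRD; apply: congr1; ring.
Qed.

Lemma cond_mean_le s : admissible s -> 0 < rsum Cn w ->
  1 - s * (rsum Cn (fun n => (occ_total n)%:R * w n) / rsum Cn w - mu)
    <= expR (E s) / (rsum Cn w / L 0).
Proof.
move=> sa Z0.
exact: (tilted_mean_le rsum_tilt0_gt0 Z0
  (cond_mean N w0 mean_ge0 weight_bound (tilt_bounded sa)) (cond_mgf_le sa)).
Qed.

End GeometricOccupations.

(** * Summability over modes *)

Section ModeSums.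
Context {R : realType}.

Lemma fsum_le_cube (X : {fset mode}) : exists K : nat, forall F : mode -> R,
  (forall k, 0 <= F k) ->
  \sum_(k <- X) F k <= \sum_(i < K) \sum_(j < K) \sum_(l < K) F (i : nat, j : nat, l : nat).
Proof.
pose m (k : mode) := maxn (maxn k.1.1 k.1.2) k.2.
pose K := (\max_(k <- X) m k).+1; exists K => F F0.
pose e (p : 'I_K * 'I_K * 'I_K) : mode := (p.1.1 : nat, p.1.2 : nat, p.2 : nat).
have einj : injective e.
  by move=> [[i j] l] [[i' j'] l'] [/val_inj -> /val_inj -> /val_inj ->].
pose Y : {fset mode} := [fset e p | p in {: 'I_K * 'I_K * 'I_K}]%fset.
have XY : {subset X <= Y}.
  move=> k kX; have mk : (m k < K)%N.
    by rewrite ltnS; apply: (@leq_bigmax_seq _ _ xpredT m).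
  move: mk; rewrite /m !gtn_max => /andP[/andP[k1 k2] k3].
  apply/imfsetP; exists (Ordinal k1, Ordinal k2, Ordinal k3) => //.
  by rewrite /e/=; case: (k) => [[]].
apply: (le_trans (ler_fsum_subset XY (fun k _ => F0 k))).
rewrite big_imfset/=; last by move=> p q _ _; exact: einj.
rewrite big_enum/= pair_bigA/= pair_bigA/=.
by rewrite le_eqVlt; apply/orP; left; apply/eqP; apply: eq_bigr => -[[i j] l].
Qed.

Lemma sum_bounded_prod3 (D : set mode) (f g h : nat -> R) (A B C : R) :
  (forall i, 0 <= f i) -> (forall i, 0 <= g i) -> (forall i, 0 <= h i) ->
  (forall n, \sum_(i < n) f i <= A) -> (forall n, \sum_(i < n) g i <= B) ->
  (forall n, \sum_(i < n) h i <= C) ->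
  sum_bounded D (fun k => f k.1.1 * g k.1.2 * h k.2) (A * B * C).
Proof.
move=> f0 g0 h0 fA gB hC X _.
have [K XK] := fsum_le_cube X.
apply: (le_trans (XK (fun k => f k.1.1 * g k.1.2 * h k.2) _)).
  by move=> k; rewrite !mulr_ge0.
rewrite (_ : \sum_(i < K) _ =
    (\sum_(i < K) f i) * (\sum_(i < K) g i) * (\sum_(i < K) h i)); last first.
  rewrite -mulrA mulr_suml; apply: eq_bigr => i _.
  rewrite mulr_suml mulr_sumr; apply: eq_bigr => j _.
  by rewrite mulrA mulr_sumr.
by rewrite !ler_pM ?mulr_ge0 ?sumr_ge0.
Qed.

Lemma pseries_bound (s : R) (n : nat) : 0 < s ->
  \sum_(i < n) (i.+1%:R : R) `^ (- (1 + s)) <= 1 + s^-1.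
Proof.
move=> s0; have i0 : 0 < s^-1 by rewrite invr_gt0.
case: n => [|n]; first by rewrite big_ord0; lra.
(* Integral comparison made inductive: n^(-(1+s)) <= ((n-1)^(-s) - n^(-s)) / s for n >= 2, so this
   sharper bound telescopes. *)
suff : \sum_(i < n.+1) (i.+1%:R : R) `^ (- (1 + s))
    <= 1 + s^-1 * (1 - n.+1%:R `^ (- s)).
  by have := powR_ge0 (n.+1%:R : R) (- s); nra.
elim: n => [|n IH]; first by rewrite big_ord1 !powR1; lra.
rewrite big_ord_recr/=; move: IH.
set a : R := n.+1%:R; set b : R := n.+2%:R.
have a0 : 0 < a by rewrite ltr0n.
have b0 : 0 < b by rewrite ltr0n.
have ab : a = b - 1 by rewrite /a /b -[n.+2]addn1 natrD addrK.
have pb : b `^ (- (1 + s)) = b `^ (- s) * b^-1.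
  by rewrite opprD addrC powRD ?powR_inv1 ?ltW// (gt_eqF b0) implybT.
have pa : a `^ (- s) = b `^ (- s) * expR (s * (ln b - ln a)).
  by rewrite /powR !gt_eqF// -expRD; congr expR; ring.
have lnab : b^-1 <= ln b - ln a.
  have b1 : b^-1 < 1 by rewrite invf_lt1// /b ltr1n.
  have := @le_ln1Dx R (- b^-1); rewrite ltrN2 b1 => /(_ isT).
  have -> : 1 - b^-1 = a / b by rewrite ab mulrBl divff ?mul1r// gt_eqF.
  by rewrite ln_div ?posrE// lerNr opprB.
clearbody a b.
have := expR_ge1Dx (s * (ln b - ln a)).
rewrite pb pa; have p0 : 0 < b `^ (- s) by rewrite powR_gt0.
set p := b `^ (- s) in p0 *; set E := expR _.
have ss : s^-1 * s = 1 by rewrite mulVf// gt_eqF.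
move=> h1 h2; set S := \sum_(i < n.+1) _ in h2 *.
have h3 : b^-1 <= s^-1 * (E - 1).
  rewrite mulrC ler_pdivlMr//; apply: le_trans (_ : s * (ln b - ln a) <= _); last by lra.
  by rewrite mulrC ler_wpM2l// ltW.
have h4 : p * b^-1 <= p * (s^-1 * (E - 1)) by rewrite ler_wpM2l// ltW.
lra.
Qed.

(** Interpolates between 2 / d^2, used for d >= 1, and 1 / d, used for d < 1. *)
Lemma bose_le_powR (d r : R) : 0 < d -> 0 <= r <= 1 ->
  bose d <= 2 * d `^ (- (1 + r)).
Proof.
move=> d0 /andP[r0 r1].
have p0 : 0 < d `^ (- (1 + r)) by rewrite powR_gt0.
have [d1|d1] := leP 1 d.
  apply: (le_trans (bose_le_inv2 d0)); rewrite ler_pM2l//.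
  have -> : d ^- 2 = expR (- (ln d *+ 2)).
    by rewrite -lnXn// expRN lnK// posrE exprn_gt0.
  rewrite /powR (gt_eqF d0) ler_expR mulr2n; have := ln_ge0 d1; nra.
apply: (le_trans (bose_le_inv d0)).
apply: (@le_trans _ _ (d `^ (- (1 + r)))); last by lra.
rewrite /powR (gt_eqF d0) -[leLHS]lnK ?posrE ?invr_gt0// ler_expR lnV ?posrE//.
have : ln d <= 0 by apply: ln_le0; exact: ltW.
nra.
Qed.

Definition mode_size (k : mode) : R :=
  (k.1.1).+1%:R ^+ 2 + (k.1.2).+1%:R ^+ 2 + (k.2).+1%:R ^+ 2.

Lemma mode_size_ge3 k : 3 <= mode_size k.
Proof.
have h (n : nat) : 1 <= (n.+1%:R : R) ^+ 2 by rewrite -natrX ler1n expn_gt0.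
rewrite /mode_size; have := h k.1.1; have := h k.1.2; have := h k.2; lra.
Qed.

(** With S the size, S^(-2) is the cube of S^(-2/3), and S >= n_j^2 turns one factor into n_j^(-4/3)
    for each direction, which is summable. *)
Lemma mode_size_inv2 k : mode_size k ^- 2 <=
  (k.1.1).+1%:R `^ (- (1 + 3^-1)) * (k.1.2).+1%:R `^ (- (1 + 3^-1)) *
  (k.2).+1%:R `^ (- (1 + 3^-1)).
Proof.
have S3 := mode_size_ge3 k.
set S := mode_size k in S3 *.
have S0 : 0 < S by lra.
have key (n : nat) : (n.+1%:R : R) ^+ 2 <= S ->
    S `^ (- (2 / 3)) <= n.+1%:R `^ (- (1 + 3^-1)).
  move=> nS; have n0 : 0 < (n.+1%:R : R) by rewrite ltr0n.
  have : ln ((n.+1%:R : R) ^+ 2) <= ln S by rewrite ler_ln ?posrE ?exprn_gt0.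
  rewrite lnXn// /powR (gt_eqF S0) (gt_eqF n0) ler_expR => h.
  rewrite mulr2n in h; lra.
have -> : S ^- 2 = S `^ (- (2 / 3)) * S `^ (- (2 / 3)) * S `^ (- (2 / 3)).
  have nz b : b ==> (S != 0) by rewrite (gt_eqF S0) implybT.
  rewrite -!powRD// /powR (gt_eqF S0).
  rewrite -[LHS]lnK ?posrE ?invr_gt0 ?exprn_gt0//; congr expR.
  by rewrite lnV ?posrE ?exprn_gt0// lnXn// mulr2n; field.
have pos (n : nat) : 0 <= (n.+1%:R : R) ^+ 2 by rewrite sqr_ge0.
have [p1 p2 p3] := And3 (pos k.1.1) (pos k.1.2) (pos k.2).
apply: ler_pM; rewrite ?mulr_ge0 ?powR_ge0//; last by apply: key; rewrite /S /mode_size; lra.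
by apply: ler_pM; rewrite ?powR_ge0//; apply: key; rewrite /S /mode_size; lra.
Qed.

Lemma mode_size_inv2_bounded D : sum_bounded D (fun k => mode_size k ^- 2) (4 * 4 * 4).
Proof.
apply: sum_bounded_le (fun k _ => mode_size_inv2 k) _.
have t : 0 < (3^-1 : R) by [].
have b n : \sum_(i < n) (i.+1%:R : R) `^ (- (1 + 3^-1)) <= 4.
  by have := pseries_bound n t; rewrite invrK; lra.
by apply: (@sum_bounded_prod3 D (fun i => i.+1%:R `^ (- (1 + 3^-1)))
  (fun i => i.+1%:R `^ (- (1 + 3^-1))) (fun i => i.+1%:R `^ (- (1 + 3^-1)))) => // i;
  exact: powR_ge0.
Qed.

(** Majorant for modes with a vanishing index: the factor [z] pins one index to 0 and leaves a
    two-dimensional sum. *)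
Definition face_weight (r : R) (k : mode) : R :=
  let p n := n.+1%:R `^ (- (1 + r)) in let z n := (n == 0%N)%:R in
  p k.1.1 * p k.1.2 * z k.2 + p k.1.1 * z k.1.2 * p k.2 + z k.1.1 * p k.1.2 * p k.2.

Lemma face_weight_ge0 r k : 0 <= face_weight r k.
Proof. by rewrite /face_weight !addr_ge0 ?mulr_ge0 ?powR_ge0 ?ler0n. Qed.

Lemma face_weight_bounded D r : 0 < r ->
  sum_bounded D (face_weight r) (3 * (1 + r^-1) ^+ 2).
Proof.
move=> r0; pose p (i : nat) : R := i.+1%:R `^ (- (1 + r)).
pose z (i : nat) : R := (i == 0%N)%:R.
have pb n : \sum_(i < n) p i <= 1 + r^-1 by exact: pseries_bound.
have p0 i : 0 <= p i by exact: powR_ge0.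
have z0 i : 0 <= z i by exact: ler0n.
have zb n : \sum_(i < n) z i <= 1.
  case: n => [|n]; first by rewrite big_ord0.
  by rewrite big_ord_recl/= big1 ?addr0.
rewrite (_ : 3 * _ = (1 + r^-1) * (1 + r^-1) * 1 + (1 + r^-1) * 1 * (1 + r^-1)
  + 1 * (1 + r^-1) * (1 + r^-1)); last by ring.
exact: (sum_boundedD (sum_boundedD (sum_bounded_prod3 (D := D) p0 p0 z0 pb pb zb)
  (sum_bounded_prod3 (D := D) p0 z0 p0 pb zb pb))
  (sum_bounded_prod3 (D := D) z0 p0 p0 zb pb pb)).
Qed.

(** A^2 + B^2 + C^2 >= A B, with A and B the sizes in the two free directions, splits the power into
    a product. *)
Lemma mode_size_face (r : R) (k : mode) : 0 <= r ->
  [|| k.1.1 == 0%N, k.1.2 == 0%N | k.2 == 0%N] ->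
  mode_size k `^ (- (1 + r)) <= face_weight r k.
Proof.
move=> r0.
have key (A B C : R) : 0 < A -> 0 < B -> 0 <= C ->
    (A ^+ 2 + B ^+ 2 + C ^+ 2) `^ (- (1 + r)) <= A `^ (- (1 + r)) * B `^ (- (1 + r)).
  move=> A0 B0 C0; rewrite -powRM ?(ltW A0) ?(ltW B0)//.
  have AB : 0 < A * B by rewrite mulr_gt0.
  have S0 : A * B <= A ^+ 2 + B ^+ 2 + C ^+ 2.
    by have := sqr_ge0 (A - B); have := sqr_ge0 C; nra.
  have Sp := lt_le_trans AB S0.
  have : ln (A * B) <= ln (A ^+ 2 + B ^+ 2 + C ^+ 2) by rewrite ler_ln ?posrE.
  rewrite /powR (gt_eqF AB) (gt_eqF Sp) ler_expR; nra.
have q n : 0 < (n.+1%:R : R) by rewrite ltr0n.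
have pp i j : 0 <= (i.+1%:R : R) `^ (- (1 + r)) * j.+1%:R `^ (- (1 + r)).
  by rewrite mulr_ge0 ?powR_ge0.
rewrite /face_weight /mode_size => /or3P[] /eqP ->; rewrite eqxx ?mulr1 ?mul1r.
- rewrite -[leLHS]add0r; apply: lerD.
    by rewrite addr_ge0 ?mulr_ge0 ?powR_ge0 ?ler0n.
  rewrite (_ : _ + _ + _ = (k.1.2).+1%:R ^+ 2 + (k.2).+1%:R ^+ 2 + 1 ^+ 2).
    exact: key.
  ring.
- rewrite -[leRHS]addrA [leRHS]addrCA -[leLHS]addr0; apply: lerD.
    rewrite (_ : _ + _ + _ = (k.1.1).+1%:R ^+ 2 + (k.2).+1%:R ^+ 2 + 1 ^+ 2).
      exact: key.
    ring.
  by rewrite addr_ge0 ?mulr_ge0 ?powR_ge0 ?ler0n.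
- rewrite -[leRHS]addrA -[leLHS]addr0; apply: lerD.
    by apply: key => //; exact: ler0n.
  by rewrite addr_ge0 ?mulr_ge0 ?powR_ge0 ?ler0n.
Qed.

End ModeSums.

(** * Gaussian sums, Gaussian integrals and the critical density *)

Section Gauss.
Context {R : realType}.
Notation mu := (@lebesgue_measure R).

Lemma gauss_fun_anti (x y : R) : 0 <= x -> x <= y -> gauss_fun y <= gauss_fun x.
Proof.
move=> x0 xy; rewrite /gauss_fun ler_expR lerN2 lerXn2r// nnegrE//.
exact: le_trans xy.
Qed.

Let mgauss (D : set R) : measurable_fun D (EFin \o @gauss_fun R).
Proof. by apply/measurable_EFinP/measurable_funTS; exact: measurable_gauss_fun. Qed.

(** [gauss_fun] decreases on the half-line, so right-endpoint rectangles of width [h] lie below its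
    graph. *)
Lemma gauss_riemann_sum (h : R) (n : nat) : 0 < h ->
  h * \sum_(i < n) gauss_fun (h * i.+1%:R) <= Num.sqrt pi / 2.
Proof.
move=> h0; rewrite -lee_fin -integral0y_gauss.
have : ((h * \sum_(i < n) gauss_fun (h * i.+1%:R))%:E <=
   \int[mu]_(x in `]0%R, (h * n%:R)%R]) (gauss_fun x)%:E)%E.
  elim: n => [|n IH].
    by rewrite big_ord0 mulr0; apply: integral_ge0 => x _; rewrite lee_fin gauss_fun_ge0.
  have hn : h * n%:R <= h * n.+1%:R by rewrite ler_pM2l// ler_nat.
  have hn0 : 0 <= h * n%:R by rewrite mulr_ge0 ?(ltW h0).
  rewrite (_ : `]0, h * n.+1%:R]%classic =
     `]0, h * n%:R] `|` `](h * n%:R), h * n.+1%:R]); last first.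
    apply/seteqP; split => x /=; rewrite !in_itv/=.
      move=> /andP[x0 xn]; case: (leP x (h * n%:R)) => xh; first by left; rewrite x0.
      by right.
    by case=> /andP[h1 h2]; apply/andP; split=> //; [exact: le_trans hn|exact: le_lt_trans hn0 _].
  rewrite ge0_integral_setU//=; last 3 first.
  - exact: mgauss.
  - by move=> x _; rewrite lee_fin gauss_fun_ge0.
  - apply/disj_set2P; rewrite -subset0 => x [] /=; rewrite !in_itv/= => /andP[_ a] /andP[b _].
    by move: (lt_le_trans b a); rewrite ltxx.
  rewrite big_ord_recr/= mulrDr EFinD; apply: leeD => //.
  apply: (@le_trans _ _ (\int[mu]_(x in `](h * n%:R)%R, (h * n.+1%:R)%R])
     cst (gauss_fun (h * n.+1%:R)%R)%:E x)%E).
    rewrite integral_cst//= lebesgue_measure_itv/= lte_fin ltr_pM2l// ltr_nat ltnSn.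
    rewrite -EFinB -EFinM lee_fin -mulrBr -natrB ?subSnn// mulr1 mulrC.
    exact: lexx.
  apply: ge0_le_integral => //=.
  - by move=> x _; rewrite lee_fin gauss_fun_ge0.
  - exact: mgauss.
  - by move=> x; rewrite in_itv/= => /andP[x1 x2]; rewrite lee_fin gauss_fun_anti// (le_trans hn0)// ltW.
move=> /le_trans; apply; apply: ge0_subset_integral => //=.
- exact: mgauss.
- by move=> x _; rewrite lee_fin gauss_fun_ge0.
- by move=> x /=; rewrite !in_itv/= andbT => /andP[/ltW].
Qed.

(** Index 0 is left out because right-endpoint rectangles start at index 1; for this reason modes
    with a zero index are bounded separately. *)
Lemma gauss_sum_le (b : R) (n : nat) : 0 < b ->
  \sum_(i < n) (if (i : nat) == 0%N then 0 else expR (- (b * i%:R ^+ 2)))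
    <= Num.sqrt (pi / b) / 2.
Proof.
move=> b0; have sb0 : 0 < Num.sqrt b by rewrite sqrtr_gt0.
case: n => [|n]; first by rewrite big_ord0 divr_ge0 ?sqrtr_ge0.
rewrite big_ord_recl/= add0r sqrtrM ?pi_ge0// sqrtrV ?(ltW b0)// [leRHS]mulrAC ler_pdivlMr//.
rewrite mulrC; apply: le_trans (gauss_riemann_sum n sb0).
rewrite ler_pM2l//; apply: ler_sum => i _.
by rewrite /gauss_fun exprMn sqr_sqrtr ?(ltW b0).
Qed.

Let derF (a y : R) : is_derive y 1 (fun y : R => y ^+ 2 / a) (2 * y / a).
Proof.
have -> : (fun y : R => y ^+ 2 / a) = (a^-1 \*: (@GRing.exp R ^~ 2%N)).
  by apply/funext => z; rewrite /= /GRing.scale/= mulrC.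
by apply: is_derive_eq; rewrite /GRing.scale/=; ring.
Qed.

Let derG (y : R) : is_derive y 1 (fun y : R => - gauss_fun y) (2 * y * gauss_fun y).
Proof.
have -> : (fun y : R => - gauss_fun y) =
   - (expR \o (- (@GRing.exp R ^~ 2%N))) by apply/funext => z.
apply: is_derive_eq; rewrite /GRing.scale/= /gauss_fun.
by rewrite [in LHS](_ : (- _) y = - y ^+ 2)//; ring.
Qed.

Let derivable_cvg (f : R -> R) (df : R -> R) :
  (forall y : R, is_derive y 1 f (df y)) -> forall y : R, f x @[x --> y] --> f y.
Proof.
by move=> fd y; apply: differentiable_continuous; apply/derivable1_diffP; exact: ex_derive.
Qed.

Let derive_fun (f : R -> R) (df : R -> R) :
  (forall y : R, is_derive y 1 f (df y)) -> derive1 f = df.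
Proof. by move=> fd; apply/funext => y; rewrite derive1E derive_val. Qed.

Let derivable_LR (f : R -> R) (df : R -> R) (a b : R) :
  (forall y : R, is_derive y 1 f (df y)) -> derivable_oo_LRcontinuous f a b.
Proof.
move=> fd; split.
- by move=> y _; exact: ex_derive.
- by apply: cvg_at_right_filter; exact: (derivable_cvg fd).
- by apply: cvg_at_left_filter; exact: (derivable_cvg fd).
Qed.

(** Substitutes x = y^2 / a, then integrates y (2 y exp(-y^2)) by parts. *)
Lemma integral_sqrt_expR (a L : R) : 0 < a -> 0 < L ->
  (\int[mu]_(x in `[0%R, (L ^+ 2 / a)%R]) (Num.sqrt x * expR (- (a * x)))%:E =
   (a * Num.sqrt a)^-1%:E *
     (\int[mu]_(x in `[0%R, L]) (gauss_fun x)%:E - (L * gauss_fun L)%:E))%E.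
Proof.
move=> a0 L0; pose F (y : R) := y ^+ 2 / a.
pose G (x : R) := Num.sqrt x * expR (- (a * x)).
have F0 : F 0 = 0 by rewrite /F expr0n mul0r.
have dF := derF a.
have cmul (c : R) (y : R) : (c * x) @[x --> y] --> c * y.
  by apply: cvgM; [exact: cvg_cst|exact: cvg_id].
have cF' (y : R) : (2 * x / a) @[x --> y] --> 2 * y / a.
  by apply: cvgM; [exact: cmul|exact: cvg_cst].
have cG : continuous G.
  move=> x; apply: cvgM; first exact: sqrt_continuous.
  apply: (@continuous_comp _ _ _ (fun x : R => - (a * x)) expR).
    by apply: cvgN; exact: cmul.
  exact: continuous_expR.
rewrite -[X in `[X, _]]F0 -/(F L) (_ : (fun x : R => (Num.sqrt x * expR (- (a * x)))%:E)
  = (fun x : R => (G x)%:E))//.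
rewrite (integration_by_substitution_increasing (F := F) (G := G) (ltW L0)); last 6 first.
- move=> x y; rewrite !in_itv/= => /andP[x0 _] /andP[y0 _] xy.
  by rewrite /F ltr_pM2r ?invr_gt0// ltr_pXn2r.
- by rewrite (derive_fun dF) => y _; exact: cF'.
- by rewrite (derive_fun dF); apply: cvgP; apply: cvg_at_right_filter; exact: cF'.
- by rewrite (derive_fun dF); apply: cvgP; apply: cvg_at_left_filter; exact: cF'.
- exact: derivable_LR dF.
- exact: continuous_subspaceT.
have cgauss := @continuous_gauss_fun R.
have c2g : continuous (fun y : R => 2 * y * gauss_fun y).
  by move=> y; apply: cvgM; [exact: cmul|exact: cgauss].
transitivity (\int[mu]_(x in `[0%R, L])
    ((a * Num.sqrt a)^-1%:E * (x * (2 * x * gauss_fun x))%:E))%E.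
  apply: eq_integral => y; rewrite inE/= in_itv/= => /andP[y0 _].
  rewrite -EFinM; congr EFin; rewrite (derive_fun dF).
  rewrite [LHS](_ : _ = Num.sqrt (y ^+ 2 / a) * expR (- (a * (y ^+ 2 / a))) * (2 * y / a))//.
  rewrite sqrtrM ?sqr_ge0// sqrtr_sqr ger0_norm// sqrtrV ?(ltW a0)//.
  rewrite (_ : a * (y ^+ 2 / a) = y ^+ 2); last by rewrite mulrCA divff ?gt_eqF// mulr1.
  rewrite /gauss_fun invfM; ring.
have idder (y : R) : is_derive y 1 (@id R) 1 by exact: is_derive_id.
rewrite ge0_integralZl//=; last 3 first.
- apply/measurable_EFinP/measurable_funTS; apply: continuous_measurable_fun.
  by move=> y; apply: cvgM; [exact: cvg_id|exact: c2g].
- move=> x; rewrite in_itv/= => /andP[x0 _].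
  by rewrite lee_fin !mulr_ge0 ?gauss_fun_ge0.
- by rewrite lee_fin invr_ge0 mulr_ge0 ?sqrtr_ge0 ?(ltW a0).
congr (_ * _)%E.
have /= -> := @integration_by_parts R id (fun y => - gauss_fun y) (fun=> 1)
  (fun y => 2 * y * gauss_fun y) 0 L L0; last 6 first.
- exact: continuous_subspaceT (@cst_continuous _ _ _).
- exact: derivable_LR idder.
- by move=> y _; rewrite (derive_fun idder).
- exact: continuous_subspaceT.
- exact: derivable_LR derG.
- by move=> y _; rewrite (derive_fun derG).
under eq_integral do rewrite mul1r EFinN.
rewrite integral_ge0N/=; last by move=> x _; rewrite lee_fin gauss_fun_ge0.
by rewrite oppeK mul0r subr0 mulrN addeC EFinN.
Qed.

(** The left side is Gamma(3/2) a^(-3/2), reached by letting L tend to infinity in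
    [integral_sqrt_expR], where the boundary term vanishes. *)
Lemma integral_sqrt_expR_ge (a : R) : 0 < a ->
  (((a * Num.sqrt a)^-1 * (Num.sqrt pi / 2))%:E <=
   \int[mu]_(x in [set x : R | (0 < x)%R]) (Num.sqrt x * expR (- (a * x)))%:E)%E.
Proof.
move=> a0; set T := (X in (_ <= X)%E).
pose I (n : nat) := (\int[mu]_(x in `[0%R, n%:R]) (gauss_fun x)%:E)%E.
have I0 n : (0 <= I n)%E.
  by apply: integral_ge0 => x _; rewrite lee_fin gauss_fun_ge0.
have cI : I n @[n --> \oo] --> (Num.sqrt pi / 2)%:E.
  rewrite -integral0y_gauss; apply: ge0_cvgn_integral => //.
    by move=> x; exact: gauss_fun_ge0.
  exact: measurable_gauss_fun.
have Ifin n : I n \is a fin_num.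
  rewrite ge0_fin_numE//; apply: (@le_lt_trans _ _ (Num.sqrt pi / 2)%:E); last exact: ltry.
  rewrite -integral0y_gauss; apply: ge0_subset_integral => //=.
  - exact: mgauss.
  - by move=> x _; rewrite lee_fin gauss_fun_ge0.
  - by move=> x /=; rewrite !in_itv/= andbT => /andP[].
have cf : fine (I n) @[n --> \oo] --> Num.sqrt pi / 2 by exact: fine_cvg cI.
have cg : (n%:R * gauss_fun n%:R : R) @[n --> \oo] --> 0.
  apply: (@squeeze_cvgr _ _ _ _ (fun=> 0) (@harmonic R)); last 2 first.
  - exact: cvg_cst.
  - exact: cvg_harmonic.
  near=> n; rewrite mulr_ge0 ?gauss_fun_ge0//= /harmonic/= /gauss_fun expRN.
  rewrite ler_pdivrMr ?expR_gt0// mulrC ler_pdivlMr ?ltr0n//.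
  (* exp(n^2) >= 1 + n^4 / 2 >= n (n + 1) for n >= 2. *)
  have := @expR_ge1Dxn R (n%:R ^+ 2) 1 (sqr_ge0 _).
  apply: le_trans; rewrite (_ : 2`! = 2)%N// -natr1.
  have n2 : 2 <= n%:R :> R by rewrite ler_nat; near: n; exists 2%N.
  move: n2; move: (n%:R : R) => m m2.
  have m4 : 4 <= m ^+ 2 by nra.
  have := ler_wpM2r (sqr_ge0 m) m4; rewrite -(expr2 (m ^+ 2)).
  by nra.
have mT : measurable_fun setT (EFin \o (fun x : R => Num.sqrt x * expR (- (a * x)))).
  apply/measurable_EFinP; apply: continuous_measurable_fun => x.
  apply: cvgM; first exact: sqrt_continuous.
  apply: (@continuous_comp _ _ _ (fun x : R => - (a * x)) expR).
    by apply: cvgN; apply: cvgM; [exact: cvg_cst|exact: cvg_id].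
  exact: continuous_expR.
have TE : T = (\int[mu]_(x in `[0%R, +oo[) (Num.sqrt x * expR (- (a * x)))%:E)%E.
  rewrite /T -integral_itv_obnd_cbnd; last exact: measurable_funS mT.
  congr (integral _ _ _); apply/seteqP; split=> x /=; rewrite in_itv/= andbT//.
have low n : (0 < n)%N ->
    (((a * Num.sqrt a)^-1 * (fine (I n) - n%:R * gauss_fun n%:R))%:E <= T)%E.
  move=> n0; rewrite EFinM EFinB fineK//.
  rewrite -integral_sqrt_expR ?ltr0n// TE; apply: ge0_subset_integral => //=.
  - exact: measurable_funS mT.
  - by move=> x /=; rewrite !in_itv/= andbT => /andP[].
have : (0 <= T)%E.
  by apply: integral_ge0 => x _; rewrite lee_fin mulr_ge0 ?sqrtr_ge0 ?expR_ge0.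
case: T low {TE} => [r| |] low // _; last exact: leey.
rewrite lee_fin.
have cl : (a * Num.sqrt a)^-1 * (fine (I n) - n%:R * gauss_fun n%:R) @[n --> \oo] -->
    (a * Num.sqrt a)^-1 * (Num.sqrt pi / 2 - 0).
  by apply: cvgM; [exact: cvg_cst|exact: cvgB].
rewrite subr0 in cl; apply: (cvgr_to_le cl); near=> n.
by rewrite -lee_fin; apply: low; near: n; exists 1%N.
Unshelve. all: by end_near. Qed.

Lemma bose_geometric (d : R) (J : nat) : 0 < d ->
  bose d = \sum_(j < J) expR (- (j.+1%:R * d)) + expR (- (J%:R * d)) * bose d.
Proof.
move=> d0; elim: J => [|J IH]; first by rewrite big_ord0 mul0r oppr0 expR0 mul1r add0r.
rewrite [LHS]IH big_ord_recr/= -addrA; congr (_ + _).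
have -> : expR (- (J%:R * d)) = expR (- (J.+1%:R * d)) * expR d.
  by rewrite -expRD; congr expR; rewrite -natr1; ring.
have h : (expR d - 1) * bose d = 1 by rewrite mulfV// gt_eqF// expRB1_gt0.
rewrite -mulrA (_ : expR d * bose d = 1 + bose d); first by ring.
by rewrite -h; ring.
Qed.

Lemma bose_geometric_ge (d : R) (J : nat) : 0 < d ->
  \sum_(j < J) expR (- (j.+1%:R * d)) <= bose d.
Proof.
move=> d0; rewrite [leRHS](bose_geometric J d0) lerDl.
by rewrite mulr_ge0 ?expR_ge0// ltW// bose_gt0.
Qed.

(** Inverse thermal wavelength at inverse temperature [a], in units where Planck's reduced constant
    and the mass are 1. *)
Definition thermal (a : R) : R := (Num.sqrt (2 * pi * a))^-1.

Lemma thermal_cube (a : R) : 0 < a -> thermal a ^+ 3 =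
  Num.sqrt 2 / (2 * pi ^+ 2) * ((a * Num.sqrt a)^-1 * (Num.sqrt pi / 2)).
Proof.
move=> a0; rewrite /thermal.
have p0 : 0 < pi :> R := pi_gt0 R.
rewrite sqrtrM ?mulr_ge0 ?(ltW p0)// sqrtrM//.
have s2 : Num.sqrt 2 ^+ 2 = 2 :> R by rewrite sqr_sqrtr.
have sp : Num.sqrt pi ^+ 2 = pi :> R by rewrite sqr_sqrtr ?(ltW p0).
have sa : Num.sqrt a ^+ 2 = a by rewrite sqr_sqrtr ?(ltW a0).
have h2 : Num.sqrt 2 != 0 :> R by rewrite gt_eqF// sqrtr_gt0.
have hp : Num.sqrt pi != 0 :> R by rewrite gt_eqF// sqrtr_gt0.
have ha : Num.sqrt a != 0 by rewrite gt_eqF// sqrtr_gt0.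
rewrite [RHS](_ : _ = Num.sqrt 2 / (Num.sqrt 2 ^+ 2 * (Num.sqrt pi ^+ 2) ^+ 2) *
  ((Num.sqrt a ^+ 2 * Num.sqrt a)^-1 * (Num.sqrt pi / Num.sqrt 2 ^+ 2)));
  last by rewrite s2 sp sa.
by field; rewrite h2 hp ha.
Qed.

(** Integrates the geometric series of the Bose factor term by term: these are partial sums of rho_c
    = sum_j (2 pi beta j)^(-3/2) over j >= 1. *)
Lemma rho_c_ge (beta : R) (J : nat) : 0 < beta ->
  ((\sum_(j < J) thermal (beta * j.+1%:R) ^+ 3)%:E <= rho_c beta)%E.
Proof.
move=> b0; set kap : R := Num.sqrt 2 / (2 * pi ^+ 2).
have k0 : 0 <= kap.
  by rewrite divr_ge0 ?sqrtr_ge0// mulr_ge0// sqr_ge0.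
pose f (j : nat) (x : R) : \bar R :=
  (kap%:E * (Num.sqrt x * expR (- (beta * j.+1%:R * x)))%:E)%E.
pose D := [set x : R | (0 < x)%R].
have DE : D = `]0, +oo[%classic.
  by apply/seteqP; split=> x /=; rewrite in_itv/= andbT.
have mD : measurable D by rewrite DE.
have cs (a : R) : continuous (fun x : R => Num.sqrt x * expR (- (a * x))).
  move=> x; apply: cvgM; first exact: sqrt_continuous.
  apply: (@continuous_comp _ _ _ (fun x : R => - (a * x)) expR).
    by apply: cvgN; apply: cvgM; [exact: cvg_cst|exact: cvg_id].
  exact: continuous_expR.
have mg (a : R) : measurable_fun D (EFin \o (fun x : R => Num.sqrt x * expR (- (a * x)))).
  apply/measurable_EFinP; apply: measurable_funTS.
  by apply: continuous_measurable_fun; exact: cs.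
have mf j : measurable_fun D (f j).
  by apply: measurable_funeM; exact: mg.
have f0 j x : D x -> (0 <= f j x)%E.
  by move=> _; rewrite mule_ge0 ?lee_fin// mulr_ge0 ?sqrtr_ge0 ?expR_ge0.
apply: (@le_trans _ _ (\int[mu]_(x in D) \sum_(j <- index_enum 'I_J) f j x)%E).
  rewrite (@ge0_integral_sum _ _ _ mu D mD 'I_J (fun j => f j) (fun j => mf j) (fun j => f0 j)).
  rewrite -sumEFin; apply: lee_sum => j _.
  rewrite /f ge0_integralZl//; last exact: mg.
  have a0 : 0 < beta * j.+1%:R by rewrite mulr_gt0 ?ltr0n.
  rewrite thermal_cube// EFinM; apply: lee_wpmul2l; first by rewrite lee_fin.
  exact: integral_sqrt_expR_ge.
rewrite /rho_c; apply: ge0_le_integral => //.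
- by move=> x Dx; apply: sume_ge0 => j _; exact: f0.
- by apply: emeasurable_sum => j; exact: mf.
- apply/measurable_EFinP; rewrite DE; apply: open_continuous_measurable_fun.
    exact: interval_open.
  move=> x; rewrite inE/= in_itv/= andbT => x0; apply: cvgM; last exact: sqrt_continuous.
  apply: cvgM; last exact: cvg_cst.
  apply: cvgV; first by rewrite gt_eqF// expRB1_gt0// mulr_gt0.
  apply: cvgB; last exact: cvg_cst.
  apply: (@continuous_comp _ _ _ (fun x : R => beta * x) expR).
    by apply: cvgM; [exact: cvg_cst|exact: cvg_id].
  exact: continuous_expR.
- move=> x Dx; rewrite /f; under eq_bigr do rewrite -EFinM.
  rewrite sumEFin lee_fin [leRHS](_ : _ = kap * (Num.sqrt x * bose (beta * x))); last first.
    by rewrite /bose /kap; ring.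
  rewrite -!mulr_sumr; do 2 (apply: ler_wpM2l; rewrite ?sqrtr_ge0//).
  have bx : 0 < beta * x by rewrite mulr_gt0.
  apply: le_trans (bose_geometric_ge J bx); apply: ler_sum => j _.
  by rewrite mulrCA mulrA.
Qed.

End Gauss.

(** * Spectral gaps of the box and the bound on the mean number of excited particles *)

Section Spectrum.
Context {R : realType}.
Variables (beta a1 a2 a3 V : R).
Hypotheses (b0 : 0 < beta) (a21 : a2 <= a1) (a32 : a3 <= a2) (V1 : 1 <= V).

Local Notation c := (beta * (pi ^+ 2 / 2)).
Local Notation v a := (V `^ (- (2 * a))).
Local Notation g := (gap beta a1 a2 a3 V).

Let V0 : 0 < V. Proof. exact: lt_le_trans V1. Qed.
Let c0 : 0 < c. Proof. by rewrite mulr_gt0 ?divr_gt0 ?exprn_gt0 ?pi_gt0. Qed.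
Let vp a : 0 < v a. Proof. exact: powR_gt0. Qed.

Let v_le a b : b <= a -> v a <= v b.
Proof. by move=> ba; apply: ler_powR => //; lra. Qed.

Lemma gapE k : g k = c * (((k.1.1).+1%:R ^+ 2 - 1) * v a1 +
   ((k.1.2).+1%:R ^+ 2 - 1) * v a2 + ((k.2).+1%:R ^+ 2 - 1) * v a3).
Proof. by rewrite /gap /eps /ground_mode/=; ring. Qed.

Let sq_ge (n : nat) : n%:R ^+ 2 <= (n.+1%:R ^+ 2 - 1 : R).
Proof. by rewrite -natr1; have := ler0n R n; nra. Qed.

Lemma excited_size k : excited k -> 6 <= mode_size k :> R.
Proof.
case: k => [[i j] l] kE; rewrite /mode_size/=.
have h (n : nat) : 1 <= (n.+1%:R : R) ^+ 2 by rewrite -natrX ler1n expn_gt0.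
have h' (n : nat) : 4 <= (n.+2%:R : R) ^+ 2.
  by rewrite -natrX ler_nat -[4%N]/(2 ^ 2)%N leq_exp2r.
move: kE; case: i => [|i]; [case: j => [|j]; [case: l => [|l]|]|] => kE.
- by case: kE.
- by have := h' l; have := h 0%N; lra.
- by have := h' j; have := h 0%N; have := h l; lra.
- by have := h' i; have := h j; have := h l; lra.
Qed.

(** As V >= 1, every V^(-2 alpha_j) is at least V^(-2 alpha_1); and a size S >= 6 gives S - 3 >= S /
    2. *)
Lemma gap_ge k : excited k -> c / 2 * v a1 * mode_size k <= g k.
Proof.
move=> /excited_size S6; rewrite gapE.
have q (n : nat) : 0 <= (n.+1%:R ^+ 2 - 1 : R).
  by apply: le_trans (sq_ge n); exact: sqr_ge0.
have v2 := v_le a21; have v3 := v_le (le_trans a32 a21).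
apply: (@le_trans _ _ (c * ((mode_size k - 3) * v a1))).
  have -> : c / 2 * v a1 * mode_size k = c * (mode_size k / 2 * v a1) by ring.
  by rewrite ler_pM2l// ler_pM2r//; lra.
rewrite ler_pM2l// /mode_size.
have := q k.1.2; have := q k.2.
set x := (k.1.1).+1%:R ^+ 2; set y := (k.1.2).+1%:R ^+ 2; set z := (k.2).+1%:R ^+ 2.
move: v2 v3; set w1 := v a1; set w2 := v a2; set w3 := v a3.
clearbody x y z w1 w2 w3; nra.
Qed.

Lemma gap_gt0 k : excited k -> 0 < g k.
Proof.
move=> kE; apply: lt_le_trans (gap_ge kE).
have S0 : 0 < mode_size k :> R by apply: lt_le_trans (excited_size kE).
by apply: mulr_gt0 => //; apply: mulr_gt0 => //; apply: divr_gt0.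
Qed.

Lemma gap_ge_min k : excited k -> 3 * c * v a1 <= g k.
Proof.
move=> kE; apply: le_trans (gap_ge kE); have := excited_size kE => S6.
have cv : 0 < c * v a1 by rewrite mulr_gt0.
have -> : 3 * c * v a1 = c * v a1 * 3 by ring.
have -> : c / 2 * v a1 * mode_size k = c * v a1 * (mode_size k / 2) by ring.
by rewrite ler_pM2l//; lra.
Qed.

Lemma gap_inv2_le k : excited k -> g k ^- 2 <= (c / 2 * v a1) ^- 2 * mode_size k ^- 2.
Proof.
move=> kE; have S6 := excited_size kE; have gk := gap_ge kE.
have p : 0 < c / 2 * v a1 by apply: mulr_gt0 => //; apply: divr_gt0.
have S0 : 0 < mode_size k :> R by lra.
have pS : 0 < c / 2 * v a1 * mode_size k by exact: mulr_gt0.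
have g0 := gap_gt0 kE.
rewrite -invfM -exprMn lef_pV2 ?posrE ?(exprn_gt0 _ pS) ?(exprn_gt0 _ g0)//.
by rewrite lerXn2r// nnegrE ltW.
Qed.

Lemma gap_inv2_bounded :
  sum_bounded excited (fun k => g k ^- 2) ((c / 2 * v a1) ^- 2 * 64).
Proof.
have p : 0 <= (c / 2 * v a1) ^- 2.
  by rewrite invr_ge0 exprn_ge0// ltW//; apply: mulr_gt0 => //; apply: divr_gt0.
apply: (sum_bounded_le gap_inv2_le); apply: sum_boundedZ => //.
have -> : 64 = 4 * 4 * 4 :> R by ring.
exact: mode_size_inv2_bounded.
Qed.

Let bulk_gap (k : mode) : R := c *
  (k.1.1%:R ^+ 2 * v a1 + k.1.2%:R ^+ 2 * v a2 + k.2%:R ^+ 2 * v a3).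

Let is_bulk (k : mode) := [&& k.1.1 != 0%N, k.1.2 != 0%N & k.2 != 0%N].

Let bulk (k : mode) : R := if is_bulk k then bose (bulk_gap k) else 0.

Let bulk_gap_gt0 k : is_bulk k -> 0 < bulk_gap k.
Proof.
move=> /and3P[k1 k2 k3]; rewrite mulr_gt0// !addr_gt0// mulr_gt0// exprn_gt0// ltr0n lt0n//.
Qed.

(** In one direction the Gaussian bound is the side length over the thermal wavelength. *)
Lemma gauss_width (a al : R) : 0 < a ->
  Num.sqrt (pi / (a * (pi ^+ 2 / 2) * v al)) / 2 = thermal a * V `^ al.
Proof.
move=> a0; rewrite /thermal; move: (pi_gt0 R); move: (pi : R) => P p0.
have vv : v al = (V `^ al) ^- 2.
  by rewrite powRN mulrC powRrM powR_mulrn ?powR_ge0.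
set W := V `^ al in vv *; have W0 : 0 < W by rewrite powR_gt0.
have e : P / (a * (P ^+ 2 / 2) * v al) = (2 * W) ^+ 2 * (2 * P * a)^-1.
  by rewrite vv; field; rewrite (gt_eqF W0) (gt_eqF a0) (gt_eqF p0).
rewrite e sqrtrM ?sqr_ge0// sqrtr_sqr ger0_norm ?mulr_ge0 ?(ltW W0)//.
rewrite sqrtrV ?mulr_ge0 ?(ltW a0) ?(ltW p0)//.
by field; rewrite gt_eqF// sqrtr_gt0 !mulr_gt0.
Qed.

(** The value 0 at index 0 matches [gauss_sum_le] and makes the product over the three directions
    vanish off the bulk. *)
Let mode_factor (a al : R) (n : nat) : R :=
  if n == 0%N then 0 else expR (- (a * (pi ^+ 2 / 2) * v al * n%:R ^+ 2)).

Let mode_factor_sum (a al : R) n : 0 < a ->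
  \sum_(i < n) mode_factor a al i <= thermal a * V `^ al.
Proof.
move=> a0; rewrite -gauss_width//; apply: gauss_sum_le.
by rewrite !mulr_gt0 ?divr_gt0 ?exprn_gt0 ?pi_gt0.
Qed.

Let mode_factor_ge0 a al n : 0 <= mode_factor a al n.
Proof. by rewrite /mode_factor; case: eqP => // _; exact: expR_ge0. Qed.

Let bulk_terms (J : nat) (k : mode) : R := \sum_(j < J)
  mode_factor (beta * j.+1%:R) a1 k.1.1 * mode_factor (beta * j.+1%:R) a2 k.1.2
  * mode_factor (beta * j.+1%:R) a3 k.2.

Let bulk_termsE J k : bulk_terms J k =
  if is_bulk k then \sum_(j < J) expR (- (j.+1%:R * bulk_gap k)) else 0.
Proof.
rewrite /bulk_terms /mode_factor /is_bulk.
case: eqP => [_|_]/=; first by rewrite big1// => j _; rewrite !mul0r.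
case: eqP => [_|_]/=; first by rewrite big1// => j _; rewrite mulr0 mul0r.
case: eqP => [_|_]/=; first by rewrite big1// => j _; rewrite mulr0.
by apply: eq_bigr => j _; rewrite -!expRD; congr expR; rewrite /bulk_gap; ring.
Qed.

Let cvg_bulk_terms k : bulk_terms J k @[J --> \oo] --> bulk k.
Proof.
under eq_fun do rewrite bulk_termsE; rewrite /bulk.
case: ifP => [kb|_]; last exact: cvg_cst.
have G0 := bulk_gap_gt0 kb.
have z1 : `|expR (- bulk_gap k)| < 1.
  by rewrite ger0_norm ?expR_ge0// expR_lt1 oppr_lt0.
have c1 := @cvg_expr R _ z1.
rewrite (_ : (fun J => \sum_(j < J) _) =
  (fun J : nat => bose (bulk_gap k) - expR (- bulk_gap k) ^+ J * bose (bulk_gap k))).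
  have : (bose (bulk_gap k) - expR (- bulk_gap k) ^+ J * bose (bulk_gap k))
      @[J --> \oo] --> bose (bulk_gap k) - 0 * bose (bulk_gap k).
    apply: cvgB; first exact: cvg_cst.
    by apply: cvgM; [exact: c1|exact: cvg_cst].
  by rewrite mul0r subr0.
apply/funext => J; rewrite [X in X - _](bose_geometric J G0) -expRM_natl mulrN.
by rewrite addrK.
Qed.

Variable rc : R.
Hypothesis rcP : forall J : nat, \sum_(j < J) thermal (beta * j.+1%:R) ^+ 3 <= rc.
Hypothesis a123 : a1 + a2 + a3 = 1.

(** After exchanging the sums, term [j] factorises over the directions and is at most
    [V * thermal (beta * j.+1%:R) ^+ 3], since the side lengths multiply to V. *)
Let bulk_bounded D : sum_bounded D bulk (V * rc).
Proof.
move=> X XD.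
have cX : \sum_(k <- X) bulk_terms J k @[J --> \oo] --> \sum_(k <- X) bulk k.
  by apply: cvg_big => [|k _]; [exact: add_continuous|exact: cvg_bulk_terms].
apply: (cvgr_to_le cX); near=> J; rewrite exchange_big/=.
apply: (@le_trans _ _ (\sum_(j < J) V * thermal (beta * j.+1%:R) ^+ 3)); last first.
  by rewrite -mulr_sumr ler_pM2l.
apply: ler_sum => j _; have a0 : 0 < beta * j.+1%:R by rewrite mulr_gt0 ?ltr0n.
have VV : V = V `^ a1 * V `^ a2 * V `^ a3.
  have nz b : b ==> (V != 0) by rewrite gt_eqF ?implybT.
  by rewrite -!powRD// a123 powRr1// ltW.
rewrite [leRHS](_ : _ = (thermal (beta * j.+1%:R) * V `^ a1) *
  (thermal (beta * j.+1%:R) * V `^ a2) * (thermal (beta * j.+1%:R) * V `^ a3)).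
  apply: (sum_bounded_prod3 (D := D) (mode_factor_ge0 _ a1) (mode_factor_ge0 _ a2)
    (mode_factor_ge0 _ a3)) => // n; exact: mode_factor_sum.
by rewrite [in LHS]VV; ring.
Unshelve. all: by end_near. Qed.

(** The bulk accounts for [V * rc], the faces for the second term; [r] stays free until that term is
    compared with V. *)
Lemma bose_gap_bounded r : 0 < r <= 1 ->
  sum_bounded excited (fun k => bose (g k))
    (V * rc + 2 * (c / 2 * v a1) `^ (- (1 + r)) * (3 * (1 + r^-1) ^+ 2)).
Proof.
move=> /andP[r0 r1].
have p : 0 < c / 2 * v a1 by apply: mulr_gt0 => //; apply: divr_gt0.
have K0 : 0 <= 2 * (c / 2 * v a1) `^ (- (1 + r)) by rewrite mulr_ge0 ?powR_ge0.
have bfB := sum_boundedD (@bulk_bounded excited)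
  (sum_boundedZ K0 (@face_weight_bounded _ excited r r0)).
apply: sum_bounded_le bfB => k kE.
have gk := gap_gt0 kE.
have [kb|kb] := boolP (is_bulk k).
  rewrite /bulk kb; apply: (@le_trans _ _ (bose (bulk_gap k))); last first.
    by rewrite lerDl mulr_ge0// face_weight_ge0.
  apply: bose_anti; first exact: bulk_gap_gt0.
  rewrite gapE /bulk_gap ler_pM2l//.
  by apply: lerD; [apply: lerD|]; rewrite ler_pM2r.
rewrite /bulk (negbTE kb) add0r; move: kb; rewrite !negb_and !negbK => kb.
have S0 : 0 < mode_size k :> R by have := excited_size kE; lra.
apply: (@le_trans _ _ (2 * g k `^ (- (1 + r)))); first by apply: bose_le_powR; rewrite ?(ltW r0).
rewrite -mulrA ler_pM2l//.
apply: (@le_trans _ _ ((c / 2 * v a1) `^ (- (1 + r)) * mode_size k `^ (- (1 + r)))).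
  rewrite -powRM ?(ltW p) ?(ltW S0)//.
  have pS : 0 < c / 2 * v a1 * mode_size k by rewrite mulr_gt0.
  have : ln (c / 2 * v a1 * mode_size k) <= ln (g k).
    by rewrite ler_ln ?posrE// gap_ge.
  rewrite /powR (gt_eqF gk) (gt_eqF pS) ler_expR; nra.
by rewrite ler_wpM2l ?powR_ge0// mode_size_face// ltW.
Qed.

End Spectrum.

(** * Passage to the limit along real sequences *)

Section Limits.
Context {R : realType}.

Lemma cvg_eql (f : nat -> R) (l l' : R) : l' = l ->
  f n @[n --> \oo] --> l' -> f n @[n --> \oo] --> l.
Proof. by move=> ->. Qed.

(** Here [p] is the probability of M <= N, [q] the Laplace transform on that event, and [y] the
    scaled error of the mean. The last hypothesis with both signs of [kap] bounds |y| by a quantity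
    of order C kap, up to the vanishing error of [p]. *)
Lemma ratio_limit (p q y d E : nat -> R) (g C k0 : R) : 0 < k0 -> 0 <= C ->
  d n @[n --> \oo] --> 0 -> E n @[n --> \oo] --> g ->
  (\forall n \near \oo, 1 - d n <= p n <= 1) ->
  (\forall n \near \oo, expR (E n) - d n <= q n <= expR (E n)) ->
  (forall kap : R, `|kap| <= k0 -> \forall n \near \oo,
     0 < p n -> 1 - kap * y n <= expR (C * kap ^+ 2) / p n) ->
  q n / p n * expR (y n) @[n --> \oo] --> expR g.
Proof.
move=> k00 C0 cd cE hp hq hy.
have cexp : expR (E n) @[n --> \oo] --> expR g.
  by apply: continuous_cvg cE; exact: continuous_expR.
have cp : p n @[n --> \oo] --> (1 : R).
  apply: (squeeze_cvgr hp); last exact: cvg_cst.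
  by apply: (cvg_eql (subr0 1)); apply: cvgB => //; exact: cvg_cst.
have cq : q n @[n --> \oo] --> expR g.
  apply: (squeeze_cvgr hq) => //.
  by apply: (cvg_eql (subr0 _)); apply: cvgB.
have cy : y n @[n --> \oo] --> 0.
  apply/cvgrPdist_le => e e0.
  (* The three bounds secure the range of the hypothesis, [C * kap ^+ 2 <= 1 / 2], and
     [3 * C * kap <= e / 2]; [C + 1] avoids dividing by 0. *)
  pose kap := Num.min k0 (Num.min (2 * (C + 1))^-1 (e / (6 * (C + 1)))).
  have C1 : 0 < C + 1 by lra.
  have kap0 : 0 < kap.
    by rewrite !lt_min k00 invr_gt0 divr_gt0 ?mulr_gt0.
  have kk : kap <= k0 by rewrite ge_min lexx.
  have k1 : kap * (2 * (C + 1)) <= 1.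
    rewrite -ler_pdivlMr ?mulr_gt0// mul1r /kap; apply/le_trans; last exact: lexx.
    by rewrite ge_min; apply/orP; right; rewrite ge_min lexx.
  have k2 : kap * (6 * (C + 1)) <= e.
    rewrite -ler_pdivlMr ?mulr_gt0// /kap.
    by rewrite ge_min; apply/orP; right; rewrite ge_min lexx orbT.
  have eC : expR (C * kap ^+ 2) - 1 <= 3 * C * kap ^+ 2.
    have h : C * kap ^+ 2 <= 1 / 2 by nra.
    have := expR_le_quad h; have : 0 <= C * kap ^+ 2 by rewrite mulr_ge0 ?sqr_ge0.
    nra.
  have cr : expR (C * kap ^+ 2) / p n @[n --> \oo] --> expR (C * kap ^+ 2).
    apply: (cvg_eql (divr1 _)); apply: cvgM; first exact: cvg_cst.
    by apply: cvgV => //; exact: oner_neq0.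
  have hk1 := hy kap; have hk2 := hy (- kap).
  rewrite normrN in hk2; rewrite gtr0_norm// in hk1 hk2.
  near=> n; rewrite sub0r normrN.
  have pn : 0 < p n.
    have : `|1 - p n| <= 1 / 2 by near: n; move/cvgrPdist_le : cp; apply.
    by rewrite ler_norml => /andP[_]; lra.
  have r1 : `|expR (C * kap ^+ 2) - expR (C * kap ^+ 2) / p n| <= kap * (e / 2).
    by near: n; move/cvgrPdist_le : cr; apply; rewrite mulr_gt0 ?divr_gt0.
  have y1 : 1 - kap * y n <= expR (C * kap ^+ 2) / p n.
    by move: pn; near: n; exact: hk1.
  have y2 : 1 - - kap * y n <= expR (C * kap ^+ 2) / p n.
    by move: pn; near: n; rewrite -(sqrrN kap); exact: hk2.
  move: r1; rewrite ler_norml => /andP[r1 _].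
  have fin : kap * (3 * C * kap + e / 2) <= kap * e.
    by rewrite ler_pM2l//; nra.
  have b1 : kap * y n <= kap * e by nra.
  have b2 : kap * - y n <= kap * e by nra.
  by rewrite !ler_pM2l// in b1 b2; rewrite ler_norml; apply/andP; split; lra.
apply: (cvg_eql (mulr1 _)); rewrite -expR0; apply: cvgM; last first.
  by apply: continuous_cvg cy; exact: continuous_expR.
apply: (cvg_eql (divr1 _)); apply: cvgM => //.
by apply: cvgV => //; exact: oner_neq0.
Unshelve. all: by end_near. Qed.

Lemma cvg_powRN (rho e : R) : 0 < rho -> 0 < e ->
  (n%:R / rho) `^ (- e) @[n --> \oo] --> 0.
Proof.
move=> r0 e0; apply/cvgrPdist_le => d d0.
near=> n; rewrite sub0r normrN ger0_norm ?powR_ge0//.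
have n0 : 0 < n%:R :> R by rewrite ltr0n; near: n; exists 1%N.
have V0 : 0 < n%:R / rho by rewrite divr_gt0.
have nbig : rho * d `^ (- e^-1) <= n%:R.
  near: n; exists (Num.truncn (rho * d `^ (- e^-1))).+1 => // n /=.
  rewrite -(ler_nat R); apply: le_trans; apply: ltW; exact: truncnS_gt.
rewrite -ler_pdivlMl// mulrC in nbig.
have l1 : - e^-1 * ln d <= ln (n%:R / rho).
  by rewrite -ln_powR ler_ln ?posrE ?powR_gt0.
rewrite /powR (gt_eqF V0) -[leRHS]lnK ?posrE// ler_expR.
have ee : e * e^-1 = 1 by rewrite divff// gt_eqF.
have := ler_wpM2l (ltW e0) l1; rewrite mulrA mulrN ee; lra.
Unshelve. all: by end_near. Qed.

(* With t -> 0 and d = x t, both t/(e^d-1) and (1-e^{-t})/(e^d-1) tend to 1/x. *)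
Lemma cvg_logmgf (t : nat -> R) (x : R) : 0 < x ->
  t n @[n --> \oo] --> 0 -> (\forall n \near \oo, 0 < t n) ->
  logmgf (t n) (bose (x * t n)) @[n --> \oo] --> - ln (1 + x^-1) + x^-1.
Proof.
move=> x0 ct tp.
have xi0 : 0 < x^-1 by rewrite invr_gt0.
have cexp (y : R) : expR (- (y * t n)) @[n --> \oo] --> (1 : R).
  rewrite -expR0; apply: continuous_cvg; first exact: continuous_expR.
  by rewrite -oppr0 -(mulr0 y); apply: cvgN; apply: cvgM => //; exact: cvg_cst.
have b1 n : 0 < t n -> x^-1 * expR (- (x * t n)) <= t n * bose (x * t n) <= x^-1.
  move=> t0; have xt : 0 < x * t n by rewrite mulr_gt0.
  have u0 := bose_gt0 xt; have ed := expRB1_gt0 xt.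
  apply/andP; split.
    rewrite ler_pdivlMr// -mulrA ler_pdivrMl//.
    have -> : expR (- (x * t n)) * (expR (x * t n) - 1) = 1 - expR (- (x * t n)).
      by rewrite mulrBr -expRD addNr expR0 mulr1.
    by have := expR_ge1Dx (- (x * t n)); lra.
  rewrite -[leRHS]mul1r ler_pdivlMr// mulrC mulrA.
  apply: (@le_trans _ _ (x * t n * (x * t n)^-1)).
    by rewrite ler_pM2l// bose_le_inv.
  by rewrite divff// gt_eqF.
have c1 : t n * bose (x * t n) @[n --> \oo] --> x^-1.
  apply: (@squeeze_cvgr _ _ _ _ (fun n => x^-1 * expR (- (x * t n))) (fun=> x^-1)).
  - by near=> n; apply: b1; near: n.
  - by apply: (cvg_eql (mulr1 _)); apply: cvgM => //; exact: cvg_cst.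
  - exact: cvg_cst.
have c2 : (1 - expR (- t n)) * bose (x * t n) @[n --> \oo] --> x^-1.
  apply: (@squeeze_cvgr _ _ _ _
    (fun n => expR (- (1 * t n)) * (t n * bose (x * t n))) (fun n => t n * bose (x * t n))) => //.
  - near=> n; have t0 : 0 < t n by near: n.
    have u0 : 0 < bose (x * t n) by rewrite bose_gt0// mulr_gt0.
    rewrite mul1r mulrA !ler_pM2r//; apply/andP; split.
      have := expR_ge1Dx (t n); have e0 := expR_gt0 (- t n).
      have : expR (- t n) * expR (t n) = 1 by rewrite -expRD addNr expR0.
      nra.
    by have := expR_ge1Dx (- t n); lra.
  - by apply: (cvg_eql (mul1r _)); apply: cvgM.
rewrite addrC; apply: cvgB => //.
apply: continuous_cvg; first by apply: continuous_ln; lra.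
by apply: cvgD => //; exact: cvg_cst.
Unshelve. all: by end_near. Qed.

End Limits.

(** * Splitting the limiting sum into g1, g2 and g3 *)

Section LimitSums.
Context {R : realType}.

Lemma rsumID (T : choiceType) (D B : set T) (f : T -> R) (C : R) :
  (forall x, D x -> 0 <= f x) -> sum_bounded D f C ->
  rsum D f = rsum (D `&` B) f + rsum (D `&` ~` B) f.
Proof.
move=> f0 fC; apply: EFin_inj.
have DB0 E x : (D `&` E) x -> 0 <= f x by case=> /f0.
have DBC E : sum_bounded (D `&` E) f C by apply: sum_bounded_sub fC => x [].
rewrite EFinD -(esum_rsum f0 fC) -(esum_rsum (@DB0 B) (DBC B)).
rewrite -(esum_rsum (@DB0 (~` B)) (DBC (~` B))).
by apply: esumID => x Dx; rewrite lee_fin f0.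
Qed.

Lemma rsum0 (T : choiceType) (D : set T) (f : T -> R) :
  (forall x, D x -> f x = 0) -> rsum D f = 0.
Proof. by move=> f0; rewrite /rsum esum1// => x /f0 ->. Qed.

Lemma rsum_reindex (T T' : choiceType) (P : set T) (Q : set T') (e : T -> T')
  (f : T' -> R) : set_bij P Q e -> rsum Q f = rsum P (f \o e).
Proof. by move=> bij; rewrite /rsum (reindex_esum _ _ _ _ bij). Qed.

(** Sorts modes by their set of excited directions: three axes carry [g1], three coordinate planes
    [g2], the interior [g3]. *)
Definition piece (b1 b2 b3 : bool) : set mode :=
  [set k | [/\ (k.1.1 != 0)%N = b1, (k.1.2 != 0)%N = b2 & (k.2 != 0)%N = b3]].

Lemma rsum_excited_pieces (f : mode -> R) (C : R) :
  (forall k, excited k -> 0 <= f k) -> sum_bounded excited f C ->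
  rsum excited f =
    rsum (piece true false false) f + rsum (piece false true false) f +
    rsum (piece false false true) f + rsum (piece true true false) f +
    rsum (piece true false true) f + rsum (piece false true true) f +
    rsum (piece true true true) f.
Proof.
move=> f0 fC.
pose A := [set k : mode | (k.1.1 != 0)%N].
pose B := [set k : mode | (k.1.2 != 0)%N].
pose E := [set k : mode | (k.2 != 0)%N].
have sub0 (X : set mode) k : (excited `&` X) k -> 0 <= f k by case=> /f0.
have subC (X : set mode) : sum_bounded (excited `&` X) f C.
  by apply: sum_bounded_sub fC => k [].
have split3 X : rsum (excited `&` X) f =
    rsum (excited `&` (X `&` B `&` E)) f + rsum (excited `&` (X `&` B `&` ~` E)) f +
    (rsum (excited `&` (X `&` ~` B `&` E)) f + rsum (excited `&` (X `&` ~` B `&` ~` E)) f).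
  rewrite (rsumID B (@sub0 X) (subC X)) -!setIA.
  rewrite (rsumID E (@sub0 (X `&` B)) (subC _)) -!setIA.
  by rewrite (rsumID E (@sub0 (X `&` ~` B)) (subC _)) -!setIA.
rewrite (rsumID A f0 fC) (split3 A) (split3 (~` A)).
have nz (n : nat) : ~ (n != 0)%N -> (n != 0)%N = false by move/negP/negbTE.
have zn (n : nat) : (n != 0)%N = false -> ~ (n != 0)%N by move=> ->.
have pieceE (X Y Z : set mode) (b1 b2 b3 : bool) : b1 || b2 || b3 ->
    (forall k, X k <-> (k.1.1 != 0)%N = b1) -> (forall k, Y k <-> (k.1.2 != 0)%N = b2) ->
    (forall k, Z k <-> (k.2 != 0)%N = b3) ->
    excited `&` (X `&` Y `&` Z) = piece b1 b2 b3.
  move=> b hX hY hZ; apply/seteqP; split=> k /=.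
    by case=> _ [[/hX ? /hY ?] /hZ ?]; split.
  case=> k1 k2 k3; split; last by split; [split; [exact/hX|exact/hY]|exact/hZ].
  by move=> kg; move: k1 k2 k3 b; rewrite kg/= => <- <- <-.
have neg (c : mode -> nat) k :
    (~` [set k | c k != 0%N]) k <-> (c k != 0%N) = false.
  by split; [exact: nz|exact: zn].
have -> : rsum (excited `&` (~` A `&` ~` B `&` ~` E)) f = 0.
  apply: rsum0 => k [kE [[]]]; rewrite /A /B /E/= => k1 k2 k3; exfalso; apply: kE.
  move: k1 k2 k3; case: k => [[[|i] [|j]] [|l]]//=.
rewrite (pieceE A B E true true true)// (pieceE A B (~` E) true true false)//;
  last exact: (neg (fun k => k.2)).
rewrite (pieceE A (~` B) E true false true)//; last exact: (neg (fun k => k.1.2)).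
rewrite (pieceE A (~` B) (~` E) true false false)//; last 2 first.
- exact: (neg (fun k => k.1.2)).
- exact: (neg (fun k => k.2)).
rewrite (pieceE (~` A) B E false true true)//; last exact: (neg (fun k => k.1.1)).
rewrite (pieceE (~` A) B (~` E) false true false)//; last 2 first.
- exact: (neg (fun k => k.1.1)).
- exact: (neg (fun k => k.2)).
rewrite (pieceE (~` A) (~` B) E false false true)//; last 2 first.
- exact: (neg (fun k => k.1.1)).
- exact: (neg (fun k => k.1.2)).
ring.
Qed.

(** Gap of the mode in the unit box without the factor [beta]; an unexcited direction adds nothing
    by [e_m1]. *)
Definition mode_energy (k : mode) : R :=
  e_m R (k.1.1).+1 + e_m R (k.1.2).+1 + e_m R (k.2).+1.

Lemma e_m1 : e_m R 1 = 0.
Proof. by rewrite /e_m expr1n subrr mulr0. Qed.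

Variables beta lam : R.
Let H k := h_lam beta lam (mode_energy k).

Let pos_pred (n : nat) : (n != 0)%N = true -> exists2 m, (2 <= m)%N & n = m.-1.
Proof. by case: n => // n _; exists n.+2. Qed.

Let pred_pos (m : nat) : (2 <= m)%N -> (m.-1 != 0)%N = true.
Proof. by case: m => [|[|m]]. Qed.

Let pred_inj (m n : nat) : (2 <= m)%N -> (2 <= n)%N -> m.-1 = n.-1 -> m = n.
Proof. by case: m => // m; case: n => // n _ _ /= ->. Qed.

Let predS (m : nat) : (2 <= m)%N -> m.-1.+1 = m.
Proof. by case: m. Qed.

Lemma rsum_piece1 (b1 b2 b3 : bool) : (b1 + b2 + b3 = 1)%N ->
  rsum (piece b1 b2 b3) H = g1 beta lam.
Proof.
pose e (m : nat) : mode := (if b1 then m.-1 else 0%N, if b2 then m.-1 else 0%N,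
  if b3 then m.-1 else 0%N).
have bij : (b1 + b2 + b3 = 1)%N ->
    set_bij [set m : nat | (2 <= m)%N] (piece b1 b2 b3) e.
  move=> b; split.
  - move=> m /= m2; rewrite /piece /e/=; have := pred_pos m2.
    by case: (b1) (b2) (b3) b => [] [] []//= _ ->.
  - move=> m n; rewrite !inE /= => m2 n2; rewrite /e.
    by case: (b1) (b2) (b3) b => [] [] []//= _ [] /(pred_inj m2 n2).
  - move=> [[i j] l]; rewrite /piece/=; rewrite /e.
    case: (b1) (b2) (b3) b => [] [] []//= _ [].
    + by move=> /pos_pred[m m2 ->] /eqP -> /eqP ->; exists m.
    + by move=> /eqP -> /pos_pred[m m2 ->] /eqP ->; exists m.
    + by move=> /eqP -> /eqP -> /pos_pred[m m2 ->]; exists m.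
move=> b; rewrite (rsum_reindex _ (bij b)) /g1 -/(rsum _ _).
apply: eq_rsum => m /= m2; rewrite /H /mode_energy /e/=.
by case: (b1) (b2) (b3) b => [] [] []//= _; rewrite predS// !e_m1 ?addr0 ?add0r.
Qed.

Lemma rsum_piece2 (b1 b2 b3 : bool) : (b1 + b2 + b3 = 2)%N ->
  rsum (piece b1 b2 b3) H = g2 beta lam.
Proof.
(* [m.1] goes to the first excited direction and [m.2] to the second; when [b1] fails, the first one
   is direction 2. *)
pose e (m : nat * nat) : mode := (if b1 then m.1.-1 else 0%N,
  if b1 then if b2 then m.2.-1 else 0%N else m.1.-1, if b3 then m.2.-1 else 0%N).
have bij : (b1 + b2 + b3 = 2)%N ->
    set_bij [set m : nat * nat | (2 <= m.1)%N /\ (2 <= m.2)%N] (piece b1 b2 b3) e.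
  move=> b; split.
  - move=> m /= [m1 m2]; rewrite /piece /e/=; have := pred_pos m1; have := pred_pos m2.
    by case: (b1) (b2) (b3) b => [] [] []//= _ -> ->.
  - move=> [m n] [m' n']; rewrite !inE /= => -[m2 n2] [m2' n2']; rewrite /e.
    case: (b1) (b2) (b3) b => [] [] []//= _ [] /(pred_inj m2 m2') ->;
      by move=> /(pred_inj n2 n2') ->.
  - move=> [[i j] l]; rewrite /piece/=; rewrite /e.
    case: (b1) (b2) (b3) b => [] [] []//= _ [].
    + by move=> /pos_pred[m m2 ->] /pos_pred[n n2 ->] /eqP ->; exists (m, n).
    + by move=> /pos_pred[m m2 ->] /eqP -> /pos_pred[n n2 ->]; exists (m, n).
    + by move=> /eqP -> /pos_pred[m m2 ->] /pos_pred[n n2 ->]; exists (m, n).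
move=> b; rewrite (rsum_reindex _ (bij b)) /g2 -/(rsum _ _).
apply: eq_rsum => m /= [m1 m2]; rewrite /H /mode_energy /e/=.
by case: (b1) (b2) (b3) b => [] [] []//= _; rewrite !predS// !e_m1 ?addr0 ?add0r.
Qed.

Lemma rsum_piece3 : rsum (piece true true true) H = g3 beta lam.
Proof.
pose e (m : nat * nat * nat) : mode := (m.1.1.-1, m.1.2.-1, m.2.-1).
have bij : set_bij [set m : nat * nat * nat |
    [/\ (2 <= m.1.1)%N, (2 <= m.1.2)%N & (2 <= m.2)%N]] (piece true true true) e.
  split.
  - by move=> m /= [m1 m2 m3]; split; exact: pred_pos.
  - move=> [[i j] l] [[i' j'] l']; rewrite !inE /= => -[i2 j2 l2] [i2' j2' l2'].
    by rewrite /e => -[] /(pred_inj i2 i2') -> /(pred_inj j2 j2') -> /(pred_inj l2 l2') ->.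
  - move=> [[i j] l]; rewrite /piece/= => -[].
    by move=> /pos_pred[m m2 ->] /pos_pred[n n2 ->] /pos_pred[q q2 ->]; exists (m, n, q).
rewrite (rsum_reindex _ bij) /g3 -/(rsum _ _).
by apply: eq_rsum => m /= [m1 m2 m3]; rewrite /H /mode_energy /e/= !predS.
Qed.

(* s2 and s3 stand for a2 = a1 and a3 = a1: a mode excited in direction j
   contributes in the limit only if alpha_j = alpha_1. *)
Definition limit_summand (s2 s3 : bool) (k : mode) : R :=
  if (s2 || (k.1.2 == 0%N)) && (s3 || (k.2 == 0%N)) then H k else 0.

(** Direction 1 always has exponent alpha_1, so 1 + s2 + s3 axes survive; the planes (1,2), (1,3),
    (2,3) need s2, s3 and both respectively, and the interior needs both. *)
Lemma rsum_limit_summand (s2 s3 : bool) (C : R) :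
  (forall k, excited k -> 0 <= limit_summand s2 s3 k) ->
  sum_bounded excited (limit_summand s2 s3) C ->
  rsum excited (limit_summand s2 s3) =
    (1 + s2%:R + s3%:R) * g1 beta lam +
    (s2%:R + s3%:R + (s2 && s3)%:R) * g2 beta lam + (s2 && s3)%:R * g3 beta lam.
Proof.
move=> f0 fC; rewrite (rsum_excited_pieces f0 fC).
have pc b1 b2 b3 : rsum (piece b1 b2 b3) (limit_summand s2 s3) =
    ((b2 ==> s2) && (b3 ==> s3))%:R * rsum (piece b1 b2 b3) H.
  case: (boolP ((b2 ==> s2) && (b3 ==> s3))) => hb; last first.
    rewrite mul0r; apply: rsum0 => k [_ k2 k3]; rewrite /limit_summand.
    case: ifP => // /andP[c2 c3]; exfalso; move: hb; rewrite -k2 -k3.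
    by move: c2 c3; case: (s2) (s3) (_ == _) (_ == _) => [] [] [] [].
  rewrite mul1r; apply: eq_rsum => k [_ k2 k3]; rewrite /limit_summand.
  by move: hb; rewrite -k2 -k3; case: (s2) (s3) (_ == _) (_ == _) => [] [] [] [].
rewrite !pc rsum_piece3 (@rsum_piece2 true true false)// (@rsum_piece2 true false true)//.
rewrite (@rsum_piece2 false true true)// (@rsum_piece1 true false false)//.
rewrite (@rsum_piece1 false true false)// (@rsum_piece1 false false true)//.
by case: (s2); case: (s3); rewrite /=; ring.
Qed.

End LimitSums.

(** * The fluctuation functional in terms of tilted sums *)

Section Fluctuations.
Context {R : realType}.
Variables (a1 a2 a3 beta rho lam : R).

Local Notation Vn N := (N%:R / rho).
Local Notation g N := (gap beta a1 a2 a3 (Vn N)).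
Local Notation w N := (weight (fun k => expR (- g N k))).
Local Notation O := (supported excited).
Local Notation Cn N := (cond O occ_total N).
Local Notation tau N := (lam * Vn N `^ (- (2 * a1))).
Local Notation mN N :=
  (rsum (Cn N) (fun n => (occ_total n)%:R * w N n) / rsum (Cn N) (w N)).

(** With N1 = N - M and V^gamma / V = V^(-2 a1), the exponent is tau (m - M), m being the
    conditional mean of M. It is split at [mu]; both [mu] and the nonzero [L] cancel, so they are
    free here. *)
Lemma fluct_mgfE (N : nat) (B L mu : R) : 0 < Vn N ->
  sum_bounded O (w N) B -> 0 < rsum (Cn N) (w N) -> L != 0 ->
  fluct_mgf beta a1 a2 a3 rho lam N =
  (rsum (Cn N) (tilt (w N) occ_total (tau N)) * expR (tau N * mu) / L) /
  (rsum (Cn N) (w N) / L) * expR (tau N * (mN N - mu)).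
Proof.
move=> V0 wB Z0 L0.
have w0 n : Cn N n -> 0 <= w N n.
  by case=> nO _; apply: weight_ge0 nO => k _; exact: expR_ge0.
have cwB : sum_bounded (Cn N) (w N) B by apply: sum_bounded_sub wB => n [].
have M0 n : Cn N n -> 0 <= (occ_total n)%:R * w N n.
  by move=> /w0 ?; rewrite mulr_ge0.
have MB : sum_bounded (Cn N) (fun n => (occ_total n)%:R * w N n) (N%:R * B).
  apply: sum_bounded_le (sum_boundedZ (ler0n R N) cwB) => n cn.
  by rewrite ler_wpM2r ?w0// ler_nat; case: cn.
have NM0 n : Cn N n -> 0 <= (N - occ_total n)%:R * w N n.
  by move=> /w0 ?; rewrite mulr_ge0.
have NMB : sum_bounded (Cn N) (fun n => (N - occ_total n)%:R * w N n) (N%:R * B).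
  apply: sum_bounded_le (sum_boundedZ (ler0n R N) cwB) => n cn.
  by rewrite ler_wpM2r ?w0// ler_nat leq_subr.
rewrite /fluct_mgf.
have -> : canon_expect beta a1 a2 a3 (Vn N) N (fun n => (N1 n)%:R / Vn N)
    = (N%:R - mN N) / Vn N.
  rewrite (@canon_expectE _ beta a1 a2 a3 (Vn N) N (fun j => j%:R / Vn N) _ _ wB).
    have -> : rsum (Cn N) (fun n => (N - occ_total n)%:R / Vn N * w N n)
        = (N%:R * rsum (Cn N) (w N)
           - rsum (Cn N) (fun n => (occ_total n)%:R * w N n)) / Vn N.
      have Vi : 0 <= (Vn N)^-1 by rewrite invr_ge0 ltW.
      rewrite (@eq_rsum _ _ _ _
        (fun n => (Vn N)^-1 * ((N - occ_total n)%:R * w N n))); last first.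
        by move=> n _; rewrite mulrAC mulrC.
      rewrite (rsumZ NM0 NMB Vi) mulrC; congr (_ / _).
      apply/eqP; rewrite eq_sym subr_eq; apply/eqP.
      rewrite -(rsumD NM0 M0 NMB MB) -(rsumZ w0 cwB (ler0n R N)).
      by apply: eq_rsum => n [_ nN]; rewrite -mulrDl -natrD subnK.
    move: Z0 V0; set z := rsum _ (w N); set m := rsum _ _; set V := Vn N.
    by move=> Z0 V0; field; rewrite (gt_eqF V0) (gt_eqF Z0).
  by move=> j; rewrite divr_ge0 ?(ltW V0).
set m := mN N; set V := Vn N.
pose phi j := expR (lam * V `^ (1 - 2 * a1) * (j%:R / V - (N%:R - m) / V)).
rewrite (@canon_expectE _ beta a1 a2 a3 V N phi B _ wB); last first.
  by move=> j; exact: expR_ge0.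
have tB : sum_bounded (Cn N) (tilt (w N) occ_total (tau N))
    (expR (`|tau N| * N%:R) * B).
  apply: sum_bounded_le (sum_boundedZ (expR_ge0 _) cwB) => n cn.
  rewrite /tilt mulrC ler_wpM2r ?w0// ler_expR.
  have : (occ_total n)%:R <= N%:R :> R by rewrite ler_nat; case: cn.
  have := ler_norm (- tau N); rewrite normrN; have := normr_ge0 (tau N).
  have := ler0n R (occ_total n); nra.
have t0 n : Cn N n -> 0 <= tilt (w N) occ_total (tau N) n.
  by move=> cn; rewrite mulr_ge0 ?expR_ge0 ?w0.
have -> : rsum (Cn N) (fun n => phi (N - occ_total n)%N * w N n)
    = expR (tau N * m) * rsum (Cn N) (tilt (w N) occ_total (tau N)).
  rewrite -(rsumZ t0 tB (expR_ge0 _)); apply: eq_rsum => n [_ nN].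
  rewrite /tilt mulrCA -expRD [RHS]mulrC; congr (expR _ * _).
  have Vg : V `^ (1 - 2 * a1) = V * V `^ (- (2 * a1)).
    by rewrite powRD ?powRr1 ?ltW// (gt_eqF V0) implybT.
  by rewrite Vg natrB// -/V; field; rewrite (gt_eqF V0).
rewrite mulrBr expRD expRN.
set x := expR (tau N * m); set y := expR (tau N * mu).
have y0 : y != 0 by rewrite gt_eqF// expR_gt0.
move: Z0; set z := rsum _ (w N); set zt := rsum _ _ => Z0.
by field; rewrite (gt_eqF Z0) L0 y0.
Qed.

End Fluctuations.

(** * Asymptotics of the conditioned law *)

Section Asymptotics.
Context {R : realType}.
Variables (a1 a2 a3 beta rho lam rc : R).
Hypotheses (a21 : a2 <= a1) (a32 : a3 <= a2) (a30 : 0 < a3).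
Hypotheses (a123 : a1 + a2 + a3 = 1) (a1h : a1 < 1 / 2).
Hypotheses (b0 : 0 < beta) (lam0 : 0 < lam) (rho0 : 0 < rho).
Hypothesis rcP : forall J : nat, \sum_(j < J) thermal (beta * j.+1%:R) ^+ 3 <= rc.
Hypothesis rcrho : rc < rho.

Local Notation c := (beta * (pi ^+ 2 / 2)).
Local Notation Vn N := (N%:R / rho).
Local Notation g N := (gap beta a1 a2 a3 (Vn N)).
Local Notation w N := (weight (fun k => expR (- g N k))).
Local Notation O := (supported excited).
Local Notation Cn N := (cond O occ_total N).
Local Notation v N := (Vn N `^ (- (2 * a1))).
Local Notation tau N := (lam * v N).
Local Notation mN N :=
  (rsum (Cn N) (fun n => (occ_total n)%:R * w N n) / rsum (Cn N) (w N)).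
Local Notation mu N := (rsum excited (fun k => bose (g N k))).
Local Notation L0 N := (rsum O (tilt (w N) occ_total 0)).
Local Notation E N s := (rsum excited (fun k => logmgf s (bose (g N k)))).

Let c0 : 0 < c. Proof. by rewrite mulr_gt0 ?divr_gt0 ?exprn_gt0 ?pi_gt0. Qed.
Let a10 : 0 < a1. Proof. exact: lt_le_trans a30 (le_trans a32 a21). Qed.

Lemma near_volume_ge (K : R) : \forall N \near \oo, K <= Vn N.
Proof.
exists (Num.truncn (K * rho)).+1 => // n /=; rewrite -(ler_nat R) => nK.
rewrite ler_pdivlMr//; apply: le_trans nK; apply: ltW; exact: truncnS_gt.
Qed.

Let v0 N : 1 <= Vn N -> 0 < v N.
Proof. by move=> V1; rewrite powR_gt0// (lt_le_trans ltr01). Qed.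

Lemma cvg_tilt_scale : tau N @[N --> \oo] --> 0.
Proof.
apply: (cvg_eql (mulr0 lam)); apply: cvgM; first exact: cvg_cst.
by apply: cvg_powRN; rewrite // mulr_gt0.
Qed.

Let near_tau : \forall N \near \oo, tau N <= 1 / 2.
Proof.
near=> N; have : `|0 - tau N| <= 1 / 2 by near: N; move/cvgrPdist_le : cvg_tilt_scale; apply.
by rewrite sub0r normrN; apply: le_trans; exact: ler_norm.
Unshelve. all: by end_near. Qed.

(** [tau] and the least gap scale alike in V, so the gap condition at [kap * tau] becomes an
    inequality free of N. *)
Let tau_admissible N (kap : R) : 1 <= Vn N -> tau N <= 1 / 2 -> `|kap| <= 1 ->
  - (4 * kap * lam) <= 3 * c -> admissible excited (g N) (kap * tau N).
Proof.
move=> V1 t2 k1 kc; have t0 : 0 < tau N by rewrite mulr_gt0 ?v0.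
split; first by rewrite normrM (gtr0_norm t0); have := normr_ge0 kap; nra.
move=> k kE; apply: le_trans (gap_ge_min b0 a21 a32 V1 kE).
rewrite (_ : - _ = - (4 * kap * lam) * v N); last by ring.
by rewrite ler_pM2r ?v0.
Qed.

(** From [rsum_logmgf_le] at s = kap tau with the bound of [gap_inv2_bounded]: the powers of V
    cancel between tau^2 and the inverse squared gap. *)
Definition fluct_const : R := 12 * lam ^+ 2 * (c / 2) ^- 2 * 64.

Let C0_ge0 : 0 <= fluct_const.
Proof.
have i0 : 0 <= (c / 2) ^- 2 by rewrite invr_ge0 sqr_ge0.
by rewrite /fluct_const; do 3 (apply: mulr_ge0 => //); exact: sqr_ge0.
Qed.

Let gp N : 1 <= Vn N -> forall k, excited k -> 0 < g N k.
Proof. by move=> V1 k; exact: gap_gt0. Qed.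

Let E_le N (kap : R) : 1 <= Vn N -> admissible excited (g N) (kap * tau N) ->
  E N (kap * tau N) <= fluct_const * kap ^+ 2.
Proof.
move=> V1 ad.
apply: le_trans (rsum_logmgf_le (gp V1) (gap_inv2_bounded b0 a21 a32 V1) ad) _.
rewrite le_eqVlt /fluct_const; apply/orP; left; apply/eqP.
move: (v0 V1) c0; move: (v N) (c) => x y x0 y0.
by field; rewrite (gt_eqF x0) (gt_eqF y0).
Qed.

(** Makes 2 a1 (1 + r) = a1 + 1/2, the midpoint of 2 a1 and 1, so the face term has order V^(1/2 +
    a1) = o(V); [r > 0] amounts to a1 < 1/2. *)
Let r : R := ((2 * a1)^-1 - 1) / 2.

Let a13 : 1 / 3 <= a1.
Proof. have := a123; have := a21; have := a32; lra. Qed.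

Let r01 : 0 < r <= 1.
Proof.
have i0 : 0 < (2 * a1)^-1 by rewrite invr_gt0 mulr_gt0.
have ii : (2 * a1)^-1 * (2 * a1) = 1 by rewrite mulVf// gt_eqF// mulr_gt0.
have h1 := a13; have h2 := a1h; apply/andP; split; rewrite /r; nra.
Qed.

Let face_const : R := 2 * (c / 2) `^ (- (1 + r)) * (3 * (1 + r^-1) ^+ 2).

Let uB N (V1 : 1 <= Vn N) := bose_gap_bounded b0 a21 a32 V1 rcP a123 r01.

Let mu_le N : 1 <= Vn N ->
  mu N <= Vn N * (rc + face_const * Vn N `^ (- (1 / 2 - a1))).
Proof.
move=> V1; have V0 : 0 < Vn N := lt_le_trans ltr01 V1.
apply: le_trans (rsum_le_bound _ (uB V1)) _.
  by move=> k kE; apply/ltW/bose_gt0; exact: gp.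
rewrite mulrDr lerD2l powRM ?(ltW (v0 V1)) ?divr_ge0 ?(ltW c0)//.
have -> : v N `^ (- (1 + r)) = Vn N * Vn N `^ (- (1 / 2 - a1)).
  have -> : Vn N * Vn N `^ (- (1 / 2 - a1)) = Vn N `^ (1 - (1 / 2 - a1)).
    by rewrite powRD ?powRr1 ?(ltW V0)// (gt_eqF V0) implybT.
  by rewrite -powRrM; congr (_ `^ _); rewrite /r; field; rewrite gt_eqF.
by rewrite le_eqVlt /face_const; apply/orP; left; apply/eqP; ring.
Qed.

(** Half of the excess density is kept as a margin; the other half absorbs the face term. *)
Let eta : R := (rho - rc) / 2.
Let eta0 : 0 < eta. Proof. by rewrite divr_gt0// subr_gt0. Qed.

Let near_mu : \forall N \near \oo, eta * Vn N <= N%:R - mu N.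
Proof.
have key (V x m : R) : 1 <= V -> x <= eta -> m <= V * (rc + x) ->
    eta * V <= rho * V - m.
  have -> : rho = rc + 2 * eta by rewrite /eta; field.
  move=> V1 xe mV; have : V * (rc + x) <= V * (rc + eta).
    by rewrite ler_pM2l ?lerD2l//; lra.
  nra.
have cf : face_const * Vn N `^ (- (1 / 2 - a1)) @[N --> \oo] --> 0.
  apply: (cvg_eql (mulr0 face_const)); apply: cvgM; first exact: cvg_cst.
  by apply: cvg_powRN => //; have := a1h; lra.
near=> N; have V1 : 1 <= Vn N by near: N; exact: near_volume_ge.
have h : face_const * Vn N `^ (- (1 / 2 - a1)) <= eta.
  apply: le_trans (ler_norm _) _; rewrite -normrN -sub0r.
  by near: N; move/cvgrPdist_le : cf; apply.
have NV : N%:R = rho * Vn N by rewrite mulrC divfK ?gt_eqF.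
by rewrite [X in X - _]NV; apply: (key _ _ _ V1 h); exact: mu_le.
Unshelve. all: by end_near. Qed.

(** Range of [kap] for which both signs of [kap * tau] satisfy the gap condition: the least gap is 3
    c V^(-2 a1), hence 4 k0 lam <= 3 c. *)
Let k0 : R := Num.min 1 (3 * c / (4 * lam)).
Let k00 : 0 < k0.
Proof. by rewrite lt_min ltr01; apply: divr_gt0; apply: mulr_gt0. Qed.

Let k0_adm (kap : R) : `|kap| <= k0 -> `|kap| <= 1 /\ - (4 * kap * lam) <= 3 * c.
Proof.
rewrite le_min => /andP[k1 k2]; split=> //.
move: k2; rewrite ler_pdivlMr ?mulr_gt0// => k2.
have := ler_wpM2r (ltW lam0) (ler_norm (- kap)); rewrite normrN; lra.
Qed.

Lemma rsum_logmgf0 N : E N 0 = 0.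
Proof.
by apply: rsum0 => k _; rewrite /logmgf oppr0 expR0 subrr !mul0r addr0 ln1 subr0.
Qed.

Let dl (N : nat) : R := expR (fluct_const * k0 ^+ 2) / (k0 * lam * eta) *
  Vn N `^ (- (1 - 2 * a1)).

(* exp(-x) <= 1/x turns the exponential Chernoff bound into a power of V. *)
Let deviation_le N s : 1 <= Vn N -> tau N <= 1 / 2 -> eta * Vn N <= N%:R - mu N ->
  0 <= s ->
  expR (- ((s + k0 * tau N) * (N%:R - mu N))) * expR (E N (- (k0 * tau N))) <= dl N.
Proof.
move=> V1 t2 hmu s0; have V0 : 0 < Vn N := lt_le_trans ltr01 V1.
have [k1 k2] : `|- k0| <= 1 /\ - (4 * - k0 * lam) <= 3 * c.
  by apply: k0_adm; rewrite normrN gtr0_norm.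
have := E_le V1 (tau_admissible V1 t2 k1 k2); rewrite mulNr sqrrN => hE.
pose x := k0 * lam * eta * Vn N `^ (1 - 2 * a1).
have x0 : 0 < x.
  apply: mulr_gt0; last exact: powR_gt0.
  by apply: mulr_gt0 => //; apply: mulr_gt0.
have vV : v N * Vn N = Vn N `^ (1 - 2 * a1).
  by rewrite addrC powRD ?powRr1 ?(ltW V0)// (gt_eqF V0) implybT.
have xle : x <= (s + k0 * tau N) * (N%:R - mu N).
  apply: (@le_trans _ _ (k0 * tau N * (eta * Vn N))).
    by rewrite /x -vV le_eqVlt; apply/orP; left; apply/eqP; ring.
  have ev : 0 < eta * Vn N by rewrite mulr_gt0.
  have kt : 0 < k0 * tau N.
    by apply: mulr_gt0 => //; apply: mulr_gt0 => //; exact: v0.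
  by apply: ler_pM => //; [exact: ltW|exact: ltW|lra].
apply: (@le_trans _ _ (x^-1 * expR (fluct_const * k0 ^+ 2))).
  apply: ler_pM; rewrite ?expR_ge0 ?ler_expR//.
  rewrite expRN lef_pV2 ?posrE ?expR_gt0//.
  apply: (@le_trans _ _ (1 + x)); first by lra.
  by apply: le_trans (expR_ge1Dx x) _; rewrite ler_expR.
rewrite /dl /x invfM -powRN le_eqVlt; apply/orP; left; apply/eqP; ring.
Qed.

Lemma cvg_fluct_mgf (G : R) : E N (tau N) @[N --> \oo] --> G ->
  fluct_mgf beta a1 a2 a3 rho lam N @[N --> \oo] --> expR G.
Proof.
move=> cE.
pose p N := rsum (Cn N) (w N) / L0 N.
pose q N := rsum (Cn N) (tilt (w N) occ_total (tau N)) * expR (tau N * mu N) / L0 N.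
pose y N := tau N * (mN N - mu N).
have L0p N : 1 <= Vn N -> 0 < L0 N.
  by move=> V1; exact: (rsum_tilt0_gt0 (gp V1) (uB V1) (gap_inv2_bounded b0 a21 a32 V1)).
have tau_admissible1 N : 1 <= Vn N -> tau N <= 1 / 2 -> admissible excited (g N) (tau N).
  move=> V1 t2; have := @tau_admissible N 1 V1 t2; rewrite mul1r; apply.
    by rewrite normr1.
  by have := c0; have := lam0; lra.
have kt_adm N : 1 <= Vn N -> tau N <= 1 / 2 -> admissible excited (g N) (- (k0 * tau N)).
  move=> V1 t2; rewrite -mulNr; have [] : `|- k0| <= 1 /\ - (4 * - k0 * lam) <= 3 * c.
    by apply: k0_adm; rewrite normrN gtr0_norm.
  exact: tau_admissible.
have hp : \forall N \near \oo, 1 - dl N <= p N <= 1.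
  near=> N; have V1 : 1 <= Vn N by near: N; exact: near_volume_ge.
  have t2 : tau N <= 1 / 2 by near: N.
  have hm : eta * Vn N <= N%:R - mu N by near: N.
  have t0 : 0 < tau N by rewrite mulr_gt0 ?v0.
  have ad0 := admissible0 (gp V1).
  have dC := gap_inv2_bounded b0 a21 a32 V1.
  (* The bounds on [p] are those on [q] with tilt 0, where the exponent vanishes. *)
  have pE : p N = rsum (Cn N) (tilt (w N) occ_total 0) * expR (0 * mu N) / L0 N.
    by rewrite mul0r expR0 mulr1 rsum_tilt0.
  rewrite pE; apply/andP; split; last first.
    by apply: le_trans (cond_mgf_le (gp V1) (uB V1) dC N ad0) _; rewrite rsum_logmgf0 expR0.
  have kt0 : 0 <= 0 + k0 * tau N by rewrite add0r mulr_ge0 ?ltW.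
  apply: le_trans (cond_mgf_ge (gp V1) (uB V1) dC N kt0 ad0 (kt_adm _ V1 t2)).
  by rewrite rsum_logmgf0 expR0 lerD2l lerN2; apply: deviation_le.
have hq : \forall N \near \oo, expR (E N (tau N)) - dl N <= q N <= expR (E N (tau N)).
  near=> N; have V1 : 1 <= Vn N by near: N; exact: near_volume_ge.
  have t2 : tau N <= 1 / 2 by near: N.
  have hm : eta * Vn N <= N%:R - mu N by near: N.
  have t0 : 0 < tau N by rewrite mulr_gt0 ?v0.
  have dC := gap_inv2_bounded b0 a21 a32 V1.
  have ta := tau_admissible1 N V1 t2.
  apply/andP; split; last exact: (cond_mgf_le (gp V1) (uB V1) dC N ta).
  have kt0 : 0 <= tau N + k0 * tau N.
    by apply: addr_ge0; [exact: ltW|apply: mulr_ge0; exact: ltW].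
  apply: le_trans (cond_mgf_ge (gp V1) (uB V1) dC N kt0 ta (kt_adm _ V1 t2)).
  by rewrite lerD2l lerN2; apply: deviation_le => //; exact: ltW.
have hy (kap : R) : `|kap| <= k0 -> \forall N \near \oo,
    0 < p N -> 1 - kap * y N <= expR (fluct_const * kap ^+ 2) / p N.
  move=> kk; have [k1 k2] := k0_adm kk.
  near=> N; move=> pN; have V1 : 1 <= Vn N by near: N; exact: near_volume_ge.
  have t2 : tau N <= 1 / 2 by near: N.
  have dC := gap_inv2_bounded b0 a21 a32 V1.
  have ad := tau_admissible V1 t2 k1 k2.
  have Z0 : 0 < rsum (Cn N) (w N).
    by move: pN; rewrite /p pmulr_lgt0// invr_gt0 L0p.
  rewrite mulrA; apply: le_trans (cond_mean_le (gp V1) (uB V1) dC ad Z0) _.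
  by rewrite ler_pM2r ?invr_gt0// ler_expR; exact: E_le.
have cd : dl N @[N --> \oo] --> 0.
  apply: (cvg_eql (mulr0 (expR (fluct_const * k0 ^+ 2) / (k0 * lam * eta)))).
  by apply: cvgM; [exact: cvg_cst|apply: cvg_powRN => //; have := a1h; lra].
have := ratio_limit k00 C0_ge0 cd cE hp hq hy.
apply: cvg_trans; apply: near_eq_cvg; near=> N.
have V1 : 1 <= Vn N by near: N; exact: near_volume_ge.
have dC := gap_inv2_bounded b0 a21 a32 V1.
have hpN : 1 - dl N <= p N <= 1 by near: N.
have Z0 : 0 < rsum (Cn N) (w N).
  have : 0 < p N.
    have : `|0 - dl N| <= 1 / 2 by near: N; move/cvgrPdist_le : cd; apply.
    rewrite sub0r normrN => /(le_trans (ler_norm _)) dN.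
    by case/andP: hpN; lra.
  by rewrite /p pmulr_lgt0// invr_gt0 L0p.
have V0 : 0 < Vn N := lt_le_trans ltr01 V1.
have Lnz : L0 N != 0 by rewrite gt_eqF// L0p.
by rewrite (@fluct_mgfE R a1 a2 a3 beta rho lam N _ (L0 N) (mu N) V0
  (weight_bound (gp V1) (uB V1) dC) Z0 Lnz).
Unshelve. all: by end_near. Qed.

End Asymptotics.

(** * Convergence of the exponent *)

Section LimitingExponent.
Context {R : realType}.
Variables (a1 a2 a3 beta rho lam : R).
Hypotheses (a21 : a2 <= a1) (a32 : a3 <= a2) (a30 : 0 < a3).
Hypotheses (b0 : 0 < beta) (lam0 : 0 < lam) (rho0 : 0 < rho).

Local Notation c := (beta * (pi ^+ 2 / 2)).
Local Notation Vn N := (N%:R / rho).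
Local Notation g N := (gap beta a1 a2 a3 (Vn N)).
Local Notation v N := (Vn N `^ (- (2 * a1))).
Local Notation tau N := (lam * v N).

Let c0 : 0 < c. Proof. by rewrite mulr_gt0 ?divr_gt0 ?exprn_gt0 ?pi_gt0. Qed.
Let a10 : 0 < a1. Proof. exact: lt_le_trans a30 (le_trans a32 a21). Qed.

(** In 12 tau^2 / gap^2 the powers of V cancel once the gap is bounded below through [mode_size], so
    the majorant does not depend on N. *)
Let dom (k : mode) : R := 12 * lam ^+ 2 * (c / 2) ^- 2 * mode_size k ^- 2.

Let dom_const : 0 <= 12 * lam ^+ 2 * (c / 2) ^- 2.
Proof.
have i0 : 0 <= (c / 2) ^- 2 by rewrite invr_ge0 sqr_ge0.
by do 2 (apply: mulr_ge0 => //); exact: sqr_ge0.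
Qed.

Let near_good : \forall N \near \oo, 1 <= Vn N /\ tau N <= 1 / 2.
Proof.
near=> N; split; first by near: N; exact: near_volume_ge.
have : `|0 - tau N| <= 1 / 2.
  by near: N; move/cvgrPdist_le : (cvg_tilt_scale lam a21 a32 a30 rho0); apply.
by rewrite sub0r normrN; apply: le_trans; exact: ler_norm.
Unshelve. all: by end_near. Qed.

Let logmgf_range N k : 1 <= Vn N -> tau N <= 1 / 2 -> excited k ->
  0 <= logmgf (tau N) (bose (g N k)) <= 12 * tau N ^+ 2 * g N k ^- 2.
Proof.
move=> V1 t2 kE; have V0 : 0 < Vn N := lt_le_trans ltr01 V1.
have t0 : 0 < tau N by rewrite mulr_gt0 ?powR_gt0.
have gk := gap_gt0 b0 a21 a32 V1 kE.
have tn : `|tau N| <= 1 / 2 by rewrite gtr0_norm.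
have tg : - (4 * tau N) <= g N k by lra.
by rewrite logmgf_ge0//= logmgf_le.
Qed.

Let near_dom : \forall N \near \oo, forall k, excited k ->
  0 <= logmgf (tau N) (bose (g N k)) <= dom k.
Proof.
apply: filterS near_good => N [V1 t2] k kE.
have V0 : 0 < Vn N := lt_le_trans ltr01 V1.
have /andP[-> h] /= := logmgf_range V1 t2 kE; apply: (le_trans h).
have t12 : 0 <= 12 * tau N ^+ 2 by rewrite mulr_ge0 ?sqr_ge0.
apply: le_trans (ler_wpM2l t12 (gap_inv2_le b0 a21 a32 V1 kE)) _.
rewrite le_eqVlt; apply/orP; left; apply/eqP; rewrite /dom [LHS]mulrA; congr (_ * _).
have v0 : 0 < v N by rewrite powR_gt0.
move: v0 c0; move: (v N) (c) => x y x0 y0.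
by field; rewrite (gt_eqF x0) (gt_eqF y0).
Qed.

Let dom_bounded : sum_bounded excited dom (12 * lam ^+ 2 * (c / 2) ^- 2 * (4 * 4 * 4)).
Proof. exact: (sum_boundedZ dom_const (@mode_size_inv2_bounded R excited)). Qed.

Lemma mode_energyE k : mode_energy k = pi ^+ 2 / 2 * (mode_size k - 3) :> R.
Proof. by rewrite /mode_energy /e_m /mode_size; ring. Qed.

Lemma mode_energy_gt0 k : excited k -> 0 < mode_energy k :> R.
Proof.
move=> /(@excited_size R) S6; rewrite mode_energyE.
by rewrite mulr_gt0 ?divr_gt0 ?exprn_gt0 ?pi_gt0//; lra.
Qed.

Let s2 := a2 == a1.
Let s3 := a3 == a1.

(** Each direction has exponent alpha_1 or is unexcited, so the gap is exactly [tau] times beta e /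
    lam, with e the [mode_energy]. *)
Let cvg_resonant k : excited k -> (s2 || (k.1.2 == 0%N)) && (s3 || (k.2 == 0%N)) ->
  logmgf (tau N) (bose (g N k)) @[N --> \oo] --> h_lam beta lam (mode_energy k).
Proof.
move=> kE /andP[k2 k3]; have e0 := mode_energy_gt0 kE.
pose x := beta * mode_energy k / lam.
have x0 : 0 < x by rewrite divr_gt0 ?mulr_gt0.
have gE N : g N k = x * tau N.
  rewrite gapE.
  have -> : ((k.1.2).+1%:R ^+ 2 - 1) * Vn N `^ (- (2 * a2)) =
      ((k.1.2).+1%:R ^+ 2 - 1) * v N.
    by case/orP: k2 => /eqP ->; rewrite // expr1n subrr !mul0r.
  have -> : ((k.2).+1%:R ^+ 2 - 1) * Vn N `^ (- (2 * a3)) =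
      ((k.2).+1%:R ^+ 2 - 1) * v N.
    by case/orP: k3 => /eqP ->; rewrite // expr1n subrr !mul0r.
  by rewrite /x /mode_energy /e_m; field; rewrite gt_eqF.
have -> : h_lam beta lam (mode_energy k) = - ln (1 + x^-1) + x^-1.
  by rewrite /h_lam /x invf_div.
under eq_fun do rewrite gE.
apply: cvg_logmgf => //; first exact: (cvg_tilt_scale lam a21 a32 a30 rho0).
apply: filterS near_good => N [V1 _]; rewrite mulr_gt0// powR_gt0//.
exact: lt_le_trans V1.
Qed.

(** A direction with exponent a < a1 forces a gap of at least c V^(-2 a), so 12 tau^2 / gap^2 decays
    like V^(-4 (a1 - a)). *)
Let cvg_suppressed k (a : R) (n : nat) : excited k -> a < a1 -> n != 0%N ->
  (forall N, 1 <= Vn N -> c * ((n.+1%:R ^+ 2 - 1) * Vn N `^ (- (2 * a))) <= g N k) ->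
  logmgf (tau N) (bose (g N k)) @[N --> \oo] --> 0.
Proof.
move=> kE aa1 n0 hg.
pose K := 12 * lam ^+ 2 * c ^- 2.
apply: (@squeeze_cvgr _ _ _ _ (fun=> 0)
  (fun N => K * (Vn N `^ (- (2 * (a1 - a))) * Vn N `^ (- (2 * (a1 - a)))))).
- apply: filterS near_good => N [V1 t2].
  have V0 : 0 < Vn N := lt_le_trans ltr01 V1.
  have /andP[-> h] /= := logmgf_range V1 t2 kE; apply: (le_trans h).
  have gk := gap_gt0 b0 a21 a32 V1 kE.
  have va : 0 < Vn N `^ (- (2 * a)) by rewrite powR_gt0.
  have cv : c * Vn N `^ (- (2 * a)) <= g N k.
    apply: le_trans (hg N V1); rewrite ler_pM2l// ler_pMl//.
    case: n n0 {hg} => // n _; rewrite lerBrDr.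
    by rewrite -[1 + 1]/(2%:R) -natrX ler_nat (@leq_trans (2 ^ 2)%N)// leq_exp2r.
  have i2 : g N k ^- 2 <= (c * Vn N `^ (- (2 * a))) ^- 2.
    have cvp : 0 < c * Vn N `^ (- (2 * a)) by exact: mulr_gt0.
    rewrite lef_pV2 ?posrE ?(exprn_gt0 _ cvp) ?(exprn_gt0 _ gk)//.
    by rewrite lerXn2r// nnegrE ltW.
  have t12 : 0 <= 12 * tau N ^+ 2 by rewrite mulr_ge0 ?sqr_ge0.
  apply: le_trans (ler_wpM2l t12 i2) _.
  have -> : Vn N `^ (- (2 * (a1 - a))) = v N / Vn N `^ (- (2 * a)).
    rewrite -powRN -powRD ?(gt_eqF V0) ?implybT//; congr (_ `^ _); ring.
  rewrite /K le_eqVlt; apply/orP; left; apply/eqP.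
  move: va c0; move: (Vn N `^ (- (2 * a))) (c) => x y x0 y0.
  by field; rewrite (gt_eqF x0) (gt_eqF y0).
- exact: cvg_cst.
- have e0 : 0 < 2 * (a1 - a) by lra.
  have cz := cvg_powRN rho0 e0.
  apply: (cvg_eql (mulr0 K)); apply: cvgM; first exact: cvg_cst.
  by apply: (cvg_eql (mulr0 0)); exact: cvgM.
Qed.

Let cvg_summand k : excited k ->
  logmgf (tau N) (bose (g N k)) @[N --> \oo] --> limit_summand beta lam s2 s3 k.
Proof.
move=> kE; rewrite /limit_summand; case: ifPn => [kc|]; first exact: cvg_resonant.
have q (n : nat) : 0 <= (n.+1%:R ^+ 2 - 1 : R).
  by rewrite subr_ge0 -natrX ler1n expn_gt0.
have vv (a : R) N : 0 <= Vn N `^ (- (2 * a)) := powR_ge0 _ _.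
rewrite negb_and !negb_or => /orP[] /andP[na kn].
  apply: (@cvg_suppressed k a2 k.1.2) => //; first by rewrite lt_neqAle na.
  move=> N V1; rewrite gapE ler_pM2l//.
  have := mulr_ge0 (q k.1.1) (vv a1 N); have := mulr_ge0 (q k.2) (vv a3 N); lra.
apply: (@cvg_suppressed k a3 k.2) => //.
  by rewrite lt_neqAle na (le_trans a32).
move=> N V1; rewrite gapE ler_pM2l//.
have := mulr_ge0 (q k.1.1) (vv a1 N); have := mulr_ge0 (q k.1.2) (vv a2 N); lra.
Qed.

Lemma cvg_limit_exponent :
  rsum excited (fun k => logmgf (tau N) (bose (g N k))) @[N --> \oo] -->
  (1 + s2%:R + s3%:R) * g1 beta lam +
    (s2%:R + s3%:R + (s2 && s3)%:R) * g2 beta lam + (s2 && s3)%:R * g3 beta lam.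
Proof.
have ls k : excited k -> 0 <= limit_summand beta lam s2 s3 k <= dom k.
  move=> kE; apply/andP; split.
    apply: (cvgr_to_ge (cvg_summand kE)).
    by apply: filterS near_dom => N /(_ k kE) /andP[].
  apply: (cvgr_to_le (cvg_summand kE)).
  by apply: filterS near_dom => N /(_ k kE) /andP[].
rewrite -(@rsum_limit_summand _ beta lam s2 s3 _ _ (sum_bounded_le _ dom_bounded)).
- exact: (rsum_dominated_cvg near_dom dom_bounded cvg_summand).
- by move=> k /ls /andP[].
- by move=> k /ls /andP[].
Qed.

End LimitingExponent.

Theorem theorem3p15 (R : realType) (a1 a2 a3 beta rho lam : R) :
  a2 <= a1 -> a3 <= a2 -> 0 < a3 -> a1 + a2 + a3 = 1 ->
  0 < beta ->
  a1 < 1 / 2 ->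
  (rho_c beta < rho%:E)%E ->
  0 < lam ->
  [/\ (a3 < a2 -> a2 < a1 ->
        fluct_mgf beta a1 a2 a3 rho lam @ \oo --> expR (g1 beta lam)),
      (a3 < a2 -> a2 = a1 ->
        fluct_mgf beta a1 a2 a3 rho lam @ \oo -->
          expR (2 * g1 beta lam + g2 beta lam)) &
      (a1 = 1 / 3 -> a2 = 1 / 3 -> a3 = 1 / 3 ->
        fluct_mgf beta a1 a2 a3 rho lam @ \oo -->
          expR (3 * g1 beta lam + 3 * g2 beta lam + g3 beta lam))].
Proof.
move=> a21 a32 a30 a123 b0 a1h hrho lam0.
have rcP J := @rho_c_ge R beta J b0.
(* The empty partial sum gives [0 <= rho_c beta], and [rho] bounds it above, so the critical density
   is a real number. *)
have rc_fin : rho_c beta \is a fin_num.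
  rewrite ge0_fin_numE; first exact: lt_trans hrho (ltry _).
  by have := rcP 0%N; rewrite big_ord0.
rewrite -(fineK rc_fin) in hrho rcP; rewrite lte_fin in hrho.
have rcP' J : \sum_(j < J) thermal (beta * j.+1%:R) ^+ 3 <= fine (rho_c beta).
  by rewrite -lee_fin.
have rho0 : 0 < rho.
  by apply: le_lt_trans hrho; have := rcP' 0%N; rewrite big_ord0.
(* One limit formula covers all cases; the Booleans [a2 == a1] and [a3 == a1] select the
   coefficients. *)
have lim (G : R) : (1 + (a2 == a1)%:R + (a3 == a1)%:R) * g1 beta lam +
    ((a2 == a1)%:R + (a3 == a1)%:R + ((a2 == a1) && (a3 == a1))%:R) * g2 beta lam +
    ((a2 == a1) && (a3 == a1))%:R * g3 beta lam = G ->
    fluct_mgf beta a1 a2 a3 rho lam @ \oo --> expR G.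
  move=> <-; exact: (cvg_fluct_mgf a21 a32 a30 a123 a1h b0 lam0 rho0 rcP' hrho
    (cvg_limit_exponent a21 a32 a30 b0 lam0 rho0)).
split.
- move=> a32' a21'; apply: lim.
  by rewrite (lt_eqF a21') (lt_eqF (lt_trans a32' a21'))/=; ring.
- by move=> a32' a21'; apply: lim; rewrite -a21' eqxx (lt_eqF a32')/=; ring.
- by move=> e1 e2 e3; apply: lim; rewrite e1 e2 e3 eqxx/=; ring.
Qed.
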